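(* Let $m>0$ and $k>0$ be positive integers. Then $$D_k\, \kappa_1(q_m(A))=\kappa_1(q_m)\sum_{(I+J)\cdot\delta-r=k}(-1)^rq_r(A)\prod_{s=1}^m q_{i_s}(q_{m-s})\,q_{j_s}(q_{m-s}),$$ where the sum is over all $I=(i_1,\ldots,i_m),\,J=(j_1,\ldots,j_m)\in\mathbb{Z}^m$ and $r\in\mathbb{Z}$ with $(I+J)\cdot\delta-r=k$, where $\delta=(1,2,\ldots,m)$, and where $I\cdot\delta$ is the usual dot product.
   Context: A strict partition is a finite weakly decreasing sequence of nonnegative integers $\lambda=(\lambda_1,\dots,\lambda_n)$ with no repeated nonzero parts. $\lambda\setminus\{\lambda_i\}:=(\lambda_1,\dots,\lambda_{i-1},\lambda_{i+1},\dots,\lambda_n)$. Let $A=\{a_1,a_2,\dots\}$ be an infinite alphabet of variables. Define $q_n=q_n(A)$ by $\kappa_z(A)=\prod_{a\in A}\frac{1+za}{1-za}=\sum_{n\in\mathbb{Z}}q_n(A)z^n$, so $q_0=1$ and $q_n=0$ for $n<0$. For $r,s\in\mathbb{Z}$ let $Q_{(r,s)}=q_rq_s+2\sum_{i=1}^s(-1)^iq_{r+i}q_{s-i}$. For $\lambda\in\mathbb{Z}^n$ with $n$ even, $Q_\lambda$ is the Pfaffian of the $n\times n$ skew-symmetric matrix whose $(i,j)$ entry is $Q_{(\lambda_i,\lambda_j)}$ for $i<j$; if $n$ is odd, $\lambda$ is replaced by $(\lambda_1,\dots,\lambda_n,0)$. Let $\Gamma=\mathbb{Q}[q_1,q_2,\dots]$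 be the ring generated by the $q_n$. The $Q_\lambda$ with $\lambda$ a strict partition form a basis of $\Gamma$. Plethysm. For a formal sum of monomials $P=\sum_\mu c_\mu x^\mu$, define $q_n(P)$ by $\kappa_z(P):=\prod_\mu\left(\frac{1+zx^\mu}{1-zx^\mu}\right)^{c_\mu}=\sum_n q_n(P)z^n$. For $G\in\Gamma$, $q_n(G)$ (also written $q_n\circ G$) means $q_n(P)$ with $P=G(A)$ regarded as a formal sum of monomials in $A$. Thus $\kappa_1(q_m)=\kappa_1(q_m(A))=\sum_{n\ge0}q_n(q_m)$, an infinite sum with finitely many terms in each degree; in particular $q_n(q_0)=q_n(1)$. Omitting the alphabet means the alphabet is $A$. Operator $D_k$ ($k$ a positive integer): the linear operator (applied degree by degree to infinite sums of homogeneous elements of $\Gamma$) with, for $\lambda$ a strict partition, $D_k(Q_\lambda)=(-1)^{i+1}2Q_{\lambda\setminus\{\lambda_i\}}$ if $k=\lambda_i$ for some $i$, and $D_k(Q_\lambda)=0$ otherwise. The identity is understood in the completion of $\Gamma$ with respect to degree (where $\deg a_i=1$). *)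

(* Defs.v *)
From HB Require Import structures.
From mathcomp Require Import all_boot all_order all_fingroup all_algebra finmap.
From mathcomp Require Import boolp classical_sets cardinality functions fsbigop.
From mathcomp.multinomials Require Import monalg.

Set Implicit Arguments.
Unset Strict Implicit.
Unset Printing Implicit Defensive.

Import GRing.Theory.

Local Open Scope classical_set_scope.
Local Open Scope ring_scope.

(* Formal power series with rational coefficients in the variables indexed by
   I, which may be infinite: arbitrary functions on the monomials {cmonom I}.
   The product is the Cauchy product; a monomial has finitely many
   factorizations, so the finitely supported sum below never degenerates. *)
Definition series (I : choiceType) : Type := {cmonom I} -> rat.

HB.instance Definition _ (I : choiceType) :=
  GRing.Zmodule.copy (series I) ({cmonom I} -> rat).

Section SeriesRing.
Variable I : choiceType.
Implicit Types (f g h : series I) (m a b : {cmonom I}).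

Definition smul f g : series I := fun m =>
  \sum_(p \in [set p : {cmonom I} * {cmonom I} | (mmul p.1 p.2 = m)%M])
     f p.1 * g p.2.

Definition sone : series I := fun m => (m == mone)%:R.

Definition mdivs m : seq {cmonom I} :=
  undup [seq mkcmonom [fsfun i : finsupp m => nat_of_ord (f i) | 0%N]
        | f : {ffun finsupp m -> 'I_(mdeg m).+1}].

Lemma mdivsP m a b : mmul a b = m -> a \in mdivs m.
Proof.
move=> abm; rewrite mem_undup; apply/mapP.
have le_a i : (a i <= mdeg m)%N.
  rewrite -abm mdegM; apply: leq_trans (leq_addr _ _).
  rewrite mdegE; case: (mdomP a i) => // ia.
  by rewrite (big_fsetD1 i) //= leq_addr.
exists [ffun i : finsupp m => inord (a (val i))]; first by rewrite mem_enum.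
apply/eqP/cmP => i; rewrite cmE /= fsfun_ffun.
case: insubP => [u ui <-|ni].
  by rewrite /= ffunE inordK ?ltnS ?le_a.
by move: ni; rewrite -cmE_neq0 -abm cmM negbK addn_eq0 => /andP[/eqP].
Qed.

Lemma mdivs_uniq m : uniq (mdivs m).
Proof. exact: undup_uniq. Qed.

Lemma smulE (r : seq {cmonom I}) f g m : uniq r ->
    (forall a b, mmul a b = m -> a \in r) ->
  smul f g m = \sum_(a <- r) \sum_(b <- r) (f a * g b) *+ (mmul a b == m).
Proof.
move=> ur sr; rewrite /smul.
have -> : [set p : {cmonom I} * {cmonom I} | mmul p.1 p.2 = m] =
    [set` [pred p : {cmonom I} * {cmonom I} | mmul p.1 p.2 == m]].
  by apply/seteqP; split=> p /= /eqP.
rewrite -(@bigfs _ _ _ _ (allpairs pair r r)) /=; first last.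
- move=> [a b] /= /eqP abm /negP[]; apply/allpairsP; exists (a, b) => /=.
  by split=> //; [apply: sr abm|apply: (sr b a); rewrite mulmC].
- by apply: allpairs_uniq => // -[? ?] [? ?].
rewrite big_mkcond big_allpairs_dep /=; apply: eq_bigr => a _.
by apply: eq_bigr => b _ /=; case: eqP.
Qed.

Lemma smulEm f g m : smul f g m =
  \sum_(a <- mdivs m) \sum_(b <- mdivs m) (f a * g b) *+ (mmul a b == m).
Proof. by apply: smulE; [apply: mdivs_uniq | apply: mdivsP]. Qed.

Lemma smulC : commutative smul.
Proof.
move=> f g; apply/funext => m; rewrite !smulEm exchange_big /=.
by apply: eq_bigr => a _; apply: eq_bigr => b _; rewrite mulrC mulmC.
Qed.

Lemma smulE3 f g h m (r := mdivs m) : smul (smul f g) h m =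
  \sum_(a <- r) \sum_(b <- r) \sum_(c <- r)
     (f a * g b * h c) *+ (mmul (mmul a b) c == m).
Proof.
rewrite smulEm -/r.
transitivity (\sum_(d <- r) \sum_(c <- r) \sum_(a <- r) \sum_(b <- r)
   (f a * g b * h c) *+ ((mmul a b == d) && (mmul d c == m))).
  apply: eq_bigr => d _; apply: eq_bigr => c _.
  case: (eqVneq (mmul d c) m) => dcm; last first.
    rewrite mulr0n big1 // => a _; rewrite big1 // => b _.
    by rewrite andbF mulr0n.
  rewrite mulr1n (@smulE r) ?mdivs_uniq //; last first.
    by move=> a b abd; apply: (@mdivsP _ a (mmul b c)); rewrite mulmA abd.
  rewrite mulr_suml; apply: eq_bigr => a _; rewrite mulr_suml.
  by apply: eq_bigr => b _; rewrite andbT mulrnAl.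
rewrite exchange_big /=.
transitivity (\sum_(c <- r) \sum_(a <- r) \sum_(b <- r)
   (f a * g b * h c) *+ (mmul (mmul a b) c == m)).
  apply: eq_bigr => c _; rewrite exchange_big; apply: eq_bigr => a _.
  rewrite exchange_big; apply: eq_bigr => b _ /=.
  case: (boolP (mmul a b \in r)) => abr.
    rewrite (bigD1_seq (mmul a b)) ?mdivs_uniq //= eqxx big1 ?addr0 // => d.
    by rewrite eq_sym => /negPf ->; rewrite mulr0n.
  have /negPf -> : mmul (mmul a b) c != m.
    by apply: contra abr => /eqP abcm; apply: mdivsP abcm.
  rewrite mulr0n big_seq big1 // => d dr.
  by case: eqP => // abd; rewrite abd dr in abr.
rewrite exchange_big; apply: eq_bigr => a _; exact: exchange_big.
Qed.

Lemma smulA : associative smul.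
Proof.
move=> f g h; rewrite smulC; apply/funext => m; rewrite !smulE3.
under eq_bigr do rewrite exchange_big /=.
rewrite exchange_big /=; apply: eq_bigr => a _; apply: eq_bigr => b _.
apply: eq_bigr => c _; rewrite mulrC mulrA.
by rewrite [mmul (mmul b c) a]mulmC mulmA.
Qed.

Lemma smul1r : left_id sone smul.
Proof.
move=> f; apply/funext => m; rewrite smulEm.
rewrite (bigD1_seq mone) ?mdivs_uniq ?(@mdivsP _ _ m) ?mul1m //=.
rewrite [X in _ + X]big1 ?addr0; last first.
  move=> a /negPf na; rewrite big1 // => b _.
  by rewrite /sone na mul0r mul0rn.
rewrite (bigD1_seq m) ?mdivs_uniq ?(@mdivsP _ m mone) ?mulm1 //=.
rewrite /sone eqxx mul1m eqxx mul1r mulr1n big1 ?addr0 // => b /negPf nb.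
by rewrite mul1m nb mulr0n.
Qed.

Lemma smulDl : left_distributive smul +%R.
Proof.
move=> f g h; apply/funext => m; have -> : (smul f h + smul g h) m = smul f h m + smul g h m by [].
rewrite !smulEm -big_split; apply: eq_bigr => a _; rewrite -big_split; apply: eq_bigr => b _ /=.
by rewrite -mulrnDl -mulrDl.
Qed.

Lemma sone_neq0 : sone != 0.
Proof. by apply/eqP => /(congr1 (@^~ mone)); rewrite /sone eqxx => /eqP. Qed.

HB.instance Definition _ := GRing.Zmodule_isComNzRing.Build (series I)
  smulA smulC smul1r smulDl sone_neq0.

Definition sscale (c : rat) f : series I := fun m => c * f m.

Lemma sscaleA c d f : sscale c (sscale d f) = sscale (c * d) f.
Proof. by apply/funext => m; rewrite /sscale mulrA. Qed.

Lemma sscale1 : left_id 1 sscale.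
Proof. by move=> f; apply/funext => m; rewrite /sscale mul1r. Qed.

Lemma sscaleDr : right_distributive sscale +%R.
Proof. by move=> c f g; apply/funext => m; rewrite /sscale mulrDr. Qed.

Lemma sscaleDl f : {morph sscale^~ f : c d / c + d}.
Proof. by move=> c d; apply/funext => m; rewrite /sscale mulrDl. Qed.

HB.instance Definition _ := GRing.Zmodule_isLmodule.Build rat (series I)
  sscaleA sscale1 sscaleDr sscaleDl.

Lemma sscaleAl (c : rat) (f g : series I) : c *: (f * g) = (c *: f) * g.
Proof.
apply/funext => m; have -> : (c *: (f * g)) m = c * smul f g m by [].
have -> : ((c *: f) * g) m = smul (c *: f) g m by [].
rewrite !smulEm mulr_sumr; apply: eq_bigr => a _; rewrite mulr_sumr.
by apply: eq_bigr => b _; rewrite mulrnAr mulrA.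
Qed.

HB.instance Definition _ :=
  GRing.Lmodule_isLalgebra.Build rat (series I) sscaleAl.
HB.instance Definition _ := GRing.Lalgebra_isComAlgebra.Build rat (series I).

End SeriesRing.

Section Infinite.
Variable I : choiceType.

Definition monom (mu : {cmonom I}) : series I := fun m => (m == mu)%:R.

(* Infinite sum, coefficient by coefficient: meaningful when every coefficient
   is nonzero in finitely many terms only. *)
Definition ssum (J : choiceType) (D : set J) (F : J -> series I) : series I :=
  fun m => \sum_(j \in D) F j m.

(* Infinite product, coefficient by coefficient: each coefficient is the
   eventual value of that coefficient in the products over finite sets. *)
Definition sprod (J : choiceType) (F : J -> series I) : series I := fun m =>
  xget 0 [set c : rat | exists S0 : {fset J}, forall S : {fset J},
                  (S0 `<=` S)%fset -> (\prod_(j <- S) F j) m = c].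

Definition gbinom (c : rat) (n : nat) : rat :=
  (\prod_(i < n) (c - i%:R)) / (n`!)%:R.

(* (1 + u) ^ c by the binomial series, for u without constant term. *)
Definition pow1D (u : series I) (c : rat) : series I :=
  ssum [set: nat] (fun n => gbinom c n *: u ^+ n).

End Infinite.

(* The alphabet A is indexed by nat. Power series in A and z are series over
   option nat, the variable None being z; zmon n mu is z^n x^mu. *)
Definition zmon (n : nat) (mu : {cmonom nat}) : {cmonom (option nat)} :=
  mkcmonom [fsfun o in (None |` [fset Some i | i in finsupp mu])%fset =>
              if o is Some i then mu i else n | 0%N].

Lemma zmonE n mu o : zmon n mu o = if o is Some i then mu i else n.
Proof.
rewrite cmE /= fsfun_fun; case: ifP => // /negP.
case: o => [i|]; last by rewrite !inE eqxx.
move=> ni; apply/esym/eqP; rewrite cmE_eq0; apply/negP => imu; apply: ni.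
by apply/fsetUP; right; apply/imfsetP; exists i.
Qed.

(* A formal sum of monomials P = \sum_mu c_mu x^mu is the series whose
   coefficient at mu is c_mu. The factor at mu is
   ((1 + z x^mu) / (1 - z x^mu)) ^ c_mu, written as a product of two powers. *)
Definition kappa (P : series nat) : series (option nat) :=
  sprod (fun mu : {cmonom nat} =>
    pow1D (monom (zmon 1 mu)) (P mu) * pow1D (- monom (zmon 1 mu)) (- P mu)).

Definition pleth_q (n : int) (P : series nat) : series nat := fun mu =>
  if n is Posz n' then kappa P (zmon n' mu) else 0.

Definition kappa1 (P : series nat) : series nat :=
  ssum [set: nat] (fun n => pleth_q n P).

Definition alphabet : series nat :=
  ssum [set: nat] (fun i => monom (ucm i)).

Definition q (n : int) : series nat := pleth_q n alphabet.

Inductive Gamma : series nat -> Prop :=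
| Gamma_q n of (0 < n)%N : Gamma (q n)
| Gamma_const (c : rat) : Gamma c%:A
| Gamma_add f g of Gamma f & Gamma g : Gamma (f + g)
| Gamma_mul f g of Gamma f & Gamma g : Gamma (f * g).

Definition Q2 (r s : int) : series nat :=
  q r * q s +
  (if s is Posz s' then
     \sum_(1 <= i < s'.+1) (-1) ^+ i * (q (r + i%:Z) * q (s - i%:Z))
   else 0) *+ 2.

Lemma ltn_double_even n (i : 'I_n) : (i.*2 < n.*2)%N.
Proof. by rewrite ltn_double. Qed.

Lemma ltn_double_odd n (i : 'I_n) : (i.*2.+1 < n.*2)%N.
Proof. by rewrite -doubleS leq_double. Qed.

Definition pfaffian (R : comAlgType rat) n (M : 'M[R]_(n.*2)) : R :=
  ((2 ^ n * n`!)%:R^-1 : rat) *: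
  \sum_(s : 'S_(n.*2)) (-1) ^+ s * \prod_(i < n)
     M (s (Ordinal (ltn_double_even i))) (s (Ordinal (ltn_double_odd i))).

Definition Qmx (l : seq int) N : 'M[series nat]_N :=
  \matrix_(i, j) if (i < j)%N then Q2 l`_i l`_j
                 else if (j < i)%N then - Q2 l`_j l`_i else 0.

Definition Q (l : seq int) : series nat :=
  let l' := if odd (size l) then rcons l 0 else l in
  pfaffian (Qmx l' ((size l')./2).*2).

Definition strict_partition (l : seq nat) : bool :=
  sorted geq l && uniq [seq x <- l | x != 0%N].

Definition QP (l : seq nat) : series nat := Q (map Posz l).

(* Only the values of D on Gamma are constrained. The position i of k in l
   is 1-based, hence i = (index k l).+1. *)
Definition is_Dop (k : nat) (D : series nat -> series nat) : Prop :=
  (forall (c : rat) f g, Gamma f -> Gamma g -> D (c *: f + g) = c *: D f + D g)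
  /\ (forall l, strict_partition l ->
        D (QP l) = if k \in l then
                     (-1) ^+ ((index k l).+1 + 1) * 2%:R * QP (rem k l)
                   else 0).

(* The Q_lambda being a basis of Gamma, is_Dop k determines D on Gamma. *)
Definition Dop (k : nat) : series nat -> series nat :=
  xget (fun=> 0) [set D | is_Dop k D].

Definition hcomp (d : nat) (F : series nat) : series nat := fun mu =>
  if mdeg mu == d then F mu else 0.

Definition degreewise (D : series nat -> series nat) (F : series nat) :
    series nat :=
  ssum [set: nat] (fun d => D (hcomp d F)).

(* Main.v *)
From HB Require Import structures.
Require Import Defs.
From mathcomp Require Import all_boot all_order all_fingroup all_algebra finmap.
From mathcomp Require Import boolp classical_sets cardinality functions fsbigop.
From mathcomp.multinomials Require Import monalg.
From mathcomp Require Import zify ring.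

Set Implicit Arguments.
Unset Strict Implicit.
Unset Printing Implicit Defensive.

Import GRing.Theory.

Local Open Scope classical_set_scope.
Local Open Scope ring_scope.

(** Write f(u, A) for a series f in the alphabet A to which a letter u has been
    added. The key point is a concrete formula for the operator D_k: on Gamma,
      D_k f = coefficient of u^k in kappa_(-1/u)(A) f(u, A)
            = sum over r of (-1)^r q_r(A) times the coefficient of u^(k+r)
              in f(u, A).
    As an alphabet with a letter added is again an infinite alphabet, u can be
    taken to be the first letter a_0, and f(u, A) is then f itself, once the
    remaining letters are renumbered. The right-hand side (Dk below) therefore
    makes sense for every series, and the theorem is a direct computation:
    q_m(u, A) = q_m(A) + 2 sum over s of u^s q_(m-s)(A), and kappa_1 turns sums
    into products and u^s q_(m-s) into the sum over i of u^(s i) q_i(q_(m-s)),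
    so that
      kappa_1(q_m)(u, A) = kappa_1(q_m) prod_s (sum_i u^(s i) q_i(q_(m-s)))^2,
    in which the factor kappa_1(q_m) is free of u. Extracting the coefficient
    of u^(k+r) yields the sum of the theorem.

    Three facts support this computation.

    - kappa. The infinite product kappa_z(P) is the only series with constant
      term 1 such that z d/dz kappa = kappa * 2 sum_(j odd) z^j psi_j(P), where
      psi_j raises the variables to the power j (euler_kappa, euler_uniq). This
      gives Newton's recursion for the q_n(P) (pleth_q_rec), multiplicativity
      (kappaD), kappa_z kappa_(-z) = 1 (kappa_neg), and the fact that q_n(q_m)
      belongs to Gamma (Gamma_pleth).

    - The values on the Q_l. Adding u changes the matrix of the Q_(l_i, l_j) by
      the rank-two matrix a b^T - b a^T with a_i = q_(l_i)(u, A) and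
      b_i = q_(l_i)(A) (Q2_shift). The Pfaffian is affine in such a
      perturbation (pfaffian_wedge), the coefficient of a_i being the Pfaffian
      in which b replaces row i, that is Q of l without l_i, up to sign
      (pfaffian_rowrep_rem). As Dk is linear over the series free of u and
      sends q_n to 2 if n = k and to 0 otherwise, it takes on the Q_l the
      values that define D_k (Dk_QP).

    - Uniqueness. D_k is only known through its values on the Q_l, so they have
      to span Gamma. Modulo products q_nu with a larger sum of squares of the
      parts, Q_l is q_l (near_eq_QP), and a product with a repeated part r
      vanishes because Q_(r, r) = 0 (qspan_repeat); an induction concludes
      (Gamma_QP_ind). *)

(* Comparing two series by unfolding their products does not terminate in
   practice. *)
Opaque smul.

(** * Coefficients and divisors of monomials *)

(** The operator x_i d/dx_i. Like the operations on monomials introduced below,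
    it is locked, as conversion would otherwise compare finitely supported
    functions by evaluation. *)
HB.lock Definition euler (I : choiceType) (i : I) (f : series I) : series I :=
  fun m => (m i)%:R * f m.

Arguments euler {I} i f.

Section Basics.
Variable I : choiceType.
Implicit Types (i : I) (f g h : series I) (m a b : {cmonom I}).

Lemma addsE f g m : (f + g) m = f m + g m. Proof. by []. Qed.

Lemma oppsE f m : (- f) m = - f m. Proof. by []. Qed.

Lemma scalesE (c : rat) f m : (c *: f) m = c * f m. Proof. by []. Qed.

Lemma onesE m : (1 : series I) m = (m == mone)%:R. Proof. by []. Qed.

Lemma monomE a m : monom a m = (m == a)%:R. Proof. by []. Qed.

Lemma monom1 : monom mone = 1 :> series I. Proof. by []. Qed.

Opaque monom.

Lemma sumsE (J : Type) (r : seq J) (P : pred J) (F : J -> series I) m :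
  (\sum_(j <- r | P j) F j) m = \sum_(j <- r | P j) F j m.
Proof. exact: (big_morph (fun f : series I => f m)). Qed.

Lemma mulsE (r : seq {cmonom I}) f g m : uniq r ->
    (forall a b, mmul a b = m -> a \in r) ->
  (f * g) m = \sum_(a <- r) \sum_(b <- r) (f a * g b) *+ (mmul a b == m).
Proof. exact: smulE. Qed.

Lemma mulsEm f g m : (f * g) m =
  \sum_(a <- mdivs m) \sum_(b <- mdivs m) (f a * g b) *+ (mmul a b == m).
Proof. exact: smulEm. Qed.

Lemma muls_neq0 f g m : (f * g) m != 0 ->
  exists a b, [/\ mmul a b = m, f a != 0 & g b != 0].
Proof.
rewrite mulsEm => nz; apply: contrapT => no; move/eqP: nz; apply.
rewrite big1 // => a _; rewrite big1 // => b _.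
case: eqP => // abm; rewrite mulr1n; apply/eqP; rewrite mulf_eq0.
apply: contrapT => /negP; rewrite negb_or => /andP[fa gb].
by apply: no; exists a, b.
Qed.

(** A coefficient of a product only involves divisors of its monomial, so this
    is a congruence for the ring operations. It allows infinite sums and
    products to be replaced by finite ones. *)
Definition eqdiv m f g := forall a b, mmul a b = m -> f a = g a.

Lemma eqdiv_self m f g : eqdiv m f g -> f m = g m.
Proof. by move=> fg; apply: (fg m mone); rewrite mulm1. Qed.

Lemma eqdivM m f f' g g' :
  eqdiv m f f' -> eqdiv m g g' -> eqdiv m (f * g) (f' * g').
Proof.
move=> ff gg d e dem; rewrite !mulsEm; apply: eq_bigr => a _.
apply: eq_bigr => b _; case: eqP => // abd; rewrite (ff a (mmul b e)).
  by rewrite (gg b (mmul a e)) // mulmA [mmul b a]mulmC abd.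
by rewrite mulmA abd.
Qed.

Lemma eqdiv_prod1 m (J : eqType) (r : seq J) (F : J -> series I) :
  (forall j, j \in r -> eqdiv m (F j) 1) -> eqdiv m (\prod_(j <- r) F j) 1.
Proof.
elim: r => [|j r IHr] F1; first by rewrite big_nil.
rewrite big_cons -[X in eqdiv _ _ X]mulr1; apply: eqdivM.
  by apply: F1; rewrite mem_head.
by apply: IHr => i ir; apply: F1; rewrite inE ir orbT.
Qed.

Lemma monomM a b : monom a * monom b = monom (mmul a b).
Proof.
apply/funext => m.
have [r [ur ar br rP]] : exists r : seq {cmonom I},
    [/\ uniq r, a \in r, b \in r & forall x y, mmul x y = m -> x \in r].
  exists (undup (a :: b :: mdivs m)); split; rewrite ?undup_uniq //.
  - by rewrite mem_undup mem_head.
  - by rewrite mem_undup !inE eqxx orbT.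
  - by move=> x y /mdivsP xm; rewrite mem_undup !inE xm !orbT.
rewrite (mulsE _ _ ur rP) (bigD1_seq a) //= [X in _ + X]big1 ?addr0; last first.
  by move=> x /negPf xa; rewrite big1 // => y _; rewrite monomE xa mul0r mul0rn.
rewrite (bigD1_seq b) //= big1 ?addr0; last first.
  by move=> y /negPf yb; rewrite !monomE yb mulr0 mul0rn.
by rewrite !monomE !eqxx mulr1 eq_sym.
Qed.

Lemma eulerE i f m : euler i f m = (m i)%:R * f m.
Proof. by rewrite euler.unlock. Qed.

Lemma eulerM i f g : euler i (f * g) = euler i f * g + f * euler i g.
Proof.
apply/funext => m; rewrite addsE !eulerE !mulsEm mulr_sumr -big_split.
apply: eq_bigr => a _; rewrite mulr_sumr -big_split; apply: eq_bigr => b _ /=.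
case: eqP => [<-|_]; last by rewrite !mulr0n mulr0 addr0.
by rewrite cmM natrD !mulr1n !eulerE; ring.
Qed.

Lemma euler1 i : euler i 1 = 0.
Proof.
apply/funext => m; rewrite !eulerE onesE; case: eqP => [->|_].
  by rewrite cm1 mul0r.
by rewrite mulr0.
Qed.

Lemma euler_prod i (J : Type) (r : seq J) (F H : J -> series I) :
    (forall j, euler i (F j) = F j * H j) ->
  euler i (\prod_(j <- r) F j) = \prod_(j <- r) F j * \sum_(j <- r) H j.
Proof.
move=> FH; elim: r => [|j r IHr]; first by rewrite !big_nil euler1 mulr0.
by rewrite !big_cons eulerM FH IHr; ring.
Qed.

End Basics.

Opaque monom.

(** * Singling out one variable *)

(** Adding a variable to those indexed by J: a bijection between I and
    option J splits a monomial over I into the exponent of the new variable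
    and a monomial over J, hence a series over I into coefficients over J. *)
Record varsplit (I J : choiceType) := VarSplit {
  dec : I -> option J;
  enc : option J -> I;
  decK : cancel dec enc;
  encK : cancel enc dec
}.

HB.lock Definition smon (I J : choiceType) (sp : varsplit I J) (n : nat)
    (mu : {cmonom J}) : {cmonom I} :=
  mkcmonom [fsfun i in
      (enc sp None |` [fset enc sp (Some j) | j in finsupp mu])%fset
    => if dec sp i is Some j then mu j else n | 0%N].

HB.lock Definition rest (I J : choiceType) (sp : varsplit I J)
    (m : {cmonom I}) : {cmonom J} :=
  mkcmonom [fsfun j in [fset odflt j (dec sp i) | i in finsupp m, j in
     (if dec sp i is Some j then [fset j] else fset0)]%fset
     => m (enc sp (Some j)) | 0%N].

HB.lock Definition coef (I J : choiceType) (sp : varsplit I J)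
    (n : nat) (f : series I) : series J :=
  fun mu => f (smon sp n mu).

HB.lock Definition embed (I J : choiceType) (sp : varsplit I J)
    (F : series J) : series I :=
  fun m => if m (enc sp None) == 0%N then F (rest sp m) else 0.

Arguments smon {I J} sp n mu.
Arguments rest {I J} sp m.
Arguments coef {I J} sp n f.
Arguments embed {I J} sp F.

Section Split.
Variables (I J : choiceType) (sp : varsplit I J).
Local Notation dec := (dec sp).
Local Notation enc := (enc sp).
Implicit Types (f g : series I) (F G : series J).
Implicit Types (m : {cmonom I}) (mu nu : {cmonom J}).

Local Notation smon := (smon sp).
Local Notation rest := (rest sp).
Local Notation coef := (coef sp).
Local Notation embed := (embed sp).

Lemma smonE n mu i : smon n mu i = if dec i is Some j then mu j else n.
Proof.
rewrite smon.unlock cmE /= fsfun_fun; case: ifP => // /negP.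
case E: (dec i) => [j|]; last by rewrite !inE -[i](decK sp) E eqxx.
move=> ni; apply/esym/eqP; rewrite cmE_eq0; apply/negP => imu; apply: ni.
by apply/fsetUP; right; apply/imfsetP; exists j => //=; rewrite -E (decK sp).
Qed.

Lemma restE m j : rest m j = m (enc (Some j)).
Proof.
rewrite rest.unlock cmE /= fsfun_fun; case: ifP => // /negP nj; apply/esym/eqP.
rewrite cmE_eq0; apply/negP => ji; apply: nj.
apply/imfset2P; exists (enc (Some j)) => //; exists j; rewrite ?(encK sp) //.
by rewrite in_fset1.
Qed.

Lemma smonK m : smon (m (enc None)) (rest m) = m.
Proof.
apply/eqP/cmP => i; rewrite smonE; case E: (dec i) => [j|].
  by rewrite restE -E (decK sp).
by rewrite -E (decK sp).
Qed.

Lemma smon_None n mu : smon n mu (enc None) = n.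
Proof. by rewrite smonE encK. Qed.

Lemma rest_smon n mu : rest (smon n mu) = mu.
Proof. by apply/eqP/cmP => j; rewrite restE smonE encK. Qed.

Lemma smonM n n' mu mu' :
  mmul (smon n mu) (smon n' mu') = smon (n + n') (mmul mu mu').
Proof.
apply/eqP/cmP => i; rewrite cmM !smonE; case: (dec i) => [j|] //.
by rewrite cmM.
Qed.

Lemma restM a b : rest (mmul a b) = mmul (rest a) (rest b).
Proof. by apply/eqP/cmP => j; rewrite cmM !restE cmM. Qed.

Lemma smon_eq n n' mu mu' :
  (smon n mu == smon n' mu') = (n == n') && (mu == mu').
Proof.
apply/eqP/andP => [E|[/eqP-> /eqP->] //].
split; first by rewrite -(smon_None n' mu') -E smon_None.
by rewrite -(rest_smon n' mu') -E rest_smon.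
Qed.

Lemma smon1 : smon 0 mone = mone.
Proof.
by apply/eqP/cmP => i; rewrite smonE cm1; case: (dec i) => [j|] //; rewrite cm1.
Qed.

Lemma coefE n f mu : coef n f mu = f (smon n mu).
Proof. by rewrite coef.unlock. Qed.

Lemma coefP f g : (forall n, coef n f = coef n g) -> f = g.
Proof.
move=> fg; apply/funext => m; rewrite -(smonK m).
by rewrite -!coefE fg.
Qed.

Lemma coefD n f g : coef n (f + g) = coef n f + coef n g.
Proof. by rewrite coef.unlock. Qed.

Lemma coefB n f g : coef n (f - g) = coef n f - coef n g.
Proof. by rewrite coef.unlock. Qed.

Lemma coefZ n (c : rat) f : coef n (c *: f) = c *: coef n f.
Proof. by rewrite coef.unlock. Qed.

Lemma coef0 n : coef n 0 = 0.
Proof. by rewrite coef.unlock. Qed.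

Lemma coef_sum n (T : Type) (r : seq T) (P : pred T) (F : T -> series I) :
  coef n (\sum_(t <- r | P t) F t) = \sum_(t <- r | P t) coef n (F t).
Proof.
apply/funext => mu; rewrite coefE !sumsE.
by apply: eq_bigr => t _; rewrite coefE.
Qed.

Lemma coefM n f g :
  coef n (f * g) = \sum_(i < n.+1) coef i f * coef (n - i) g.
Proof.
apply/funext => mu; rewrite sumsE !coefE.
pose r := mdivs mu; pose s := iota 0 n.+1.
pose t := [seq smon i a | i <- s, a <- r].
have ut : uniq t.
  apply: allpairs_uniq; rewrite ?iota_uniq ?mdivs_uniq //.
  by move=> [i a] [j b] _ _ /= /eqP; rewrite smon_eq => /andP[/eqP-> /eqP->].
have tP a b : mmul a b = smon n mu -> a \in t.
  rewrite -(smonK a) -(smonK b) smonM => /eqP.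
  rewrite smon_eq => /andP[/eqP abn /eqP abm].
  apply/allpairsP; exists (a (enc None), rest a) => /=; split=> //.
    by rewrite mem_iota ltnS -abn leq_addr.
  exact: mdivsP abm.
have bt (F : {cmonom I} -> rat) :
    \sum_(a <- t) F a = \sum_(i <- s) \sum_(a <- r) F (smon i a).
  by rewrite big_flatten big_map; apply: eq_bigr => i _; rewrite big_map.
rewrite (mulsE _ _ ut tP) bt -(big_mkord predT (fun i =>
  (coef i f * coef (n - i) g) mu)) /index_iota subn0.
rewrite big_seq [RHS]big_seq; apply: eq_bigr => i.
rewrite /s mem_iota /= ltnS => lin.
rewrite mulsEm; apply: eq_bigr => a _.
have nis : (n - i)%N \in s by rewrite /s mem_iota ltnS leq_subr.
rewrite bt (bigD1_seq _ nis (iota_uniq _ _)) /=.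
rewrite [X in _ + X]big1 ?addr0; last first.
  move=> j /negPf nj; rewrite big1 // => b _; rewrite smonM smon_eq.
  suff -> : (i + j == n)%N = false by [].
  by apply/negP => /eqP E; rewrite -E addKn eqxx in nj.
by apply: eq_bigr => b _; rewrite smonM smon_eq subnKC // eqxx !coefE.
Qed.

Lemma coef0M f g : coef 0 (f * g) = coef 0 f * coef 0 g.
Proof. by rewrite coefM big_ord_recl big_ord0 subn0 addr0. Qed.

Lemma coef1 n : coef n 1 = (n == 0%N)%:R.
Proof.
apply/funext => mu; rewrite !coefE onesE -smon1 smon_eq.
by case: n => [|n] //=.
Qed.

Lemma coef01 : coef 0 1 = 1.
Proof. by rewrite coef1 eqxx mulr1n. Qed.

Lemma coef_monom n n' mu :
  coef n (monom (smon n' mu)) = if n == n' then monom mu else 0.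
Proof.
apply/funext => nu; rewrite !coefE monomE smon_eq.
by case: (n == n'); rewrite ?monomE.
Qed.

Lemma coef_euler n f : coef n (euler (enc None) f) = n%:R *: coef n f.
Proof. by apply/funext => mu; rewrite scalesE !coefE eulerE smon_None. Qed.

Lemma coef_monomM n n' mu f : coef n (monom (smon n' mu) * f) =
  if (n' <= n)%N then monom mu * coef (n - n') f else 0.
Proof.
rewrite coefM; case: leqP => nn'.
  rewrite (bigD1 (Ordinal (nn' : (n' < n.+1)%N))) //= coef_monom eqxx.
  rewrite big1 ?addr0 // => i /negPf ni; rewrite coef_monom.
  by rewrite -(inj_eq val_inj) /= in ni; rewrite ni mul0r.
rewrite big1 // => i _; rewrite coef_monom.
by rewrite ltn_eqF ?mul0r //; apply: leq_trans nn'.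
Qed.

Lemma embedE F m :
  embed F m = if m (enc None) == 0%N then F (rest m) else 0.
Proof. by rewrite embed.unlock. Qed.

Lemma coef_embed n F : coef n (embed F) = if n == 0%N then F else 0.
Proof.
apply/funext => mu; rewrite coefE embedE smon_None rest_smon.
by case: (n == 0%N).
Qed.

Lemma coef_embedM n f F : coef n (embed F * f) = F * coef n f.
Proof.
rewrite coefM (bigD1 ord0) //= coef_embed subn0 big1 ?addr0 // => i /negPf ni.
by rewrite -(inj_eq val_inj) /= in ni; rewrite coef_embed ni mul0r.
Qed.

Lemma embed1 : embed 1 = 1.
Proof. by apply: coefP => n; rewrite coef_embed coef1; case: eqP. Qed.

Lemma embedM F G : embed (F * G) = embed F * embed G.
Proof.
apply: coefP => n; rewrite coef_embedM !coef_embed.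
by case: eqP => // _; rewrite mulr0.
Qed.

Lemma embedD F G : embed (F + G) = embed F + embed G.
Proof.
by apply: coefP => n; rewrite coefD !coef_embed; case: eqP; rewrite ?addr0.
Qed.

Lemma embedN F : embed (- F) = - embed F.
Proof.
by apply/funext => m; rewrite oppsE !embedE; case: eqP; rewrite ?oppr0.
Qed.

Lemma embed0 : embed 0 = 0.
Proof. by apply/funext => m; rewrite !embedE; case: eqP. Qed.

Lemma embedZ (c : rat) F : embed (c *: F) = c *: embed F.
Proof.
by apply/funext => m; rewrite scalesE !embedE; case: eqP; rewrite ?mulr0.
Qed.

Lemma embed_sum (T : Type) (r : seq T) (P : pred T) (F : T -> series J) :
  embed (\sum_(t <- r | P t) F t) = \sum_(t <- r | P t) embed (F t).
Proof. exact: (big_morph embed embedD embed0). Qed.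

Lemma embed_prod (T : Type) (r : seq T) (P : pred T) (F : T -> series J) :
  embed (\prod_(t <- r | P t) F t) = \prod_(t <- r | P t) embed (F t).
Proof. exact: (big_morph embed embedM embed1). Qed.

End Split.

(** * Adams operations *)

HB.lock Definition scalem (I : choiceType) (n : nat) (m : {cmonom I}) :
    {cmonom I} :=
  mkcmonom [fsfun i in finsupp m => (n * m i)%N | 0%N].

HB.lock Definition rootm (I : choiceType) (n : nat) (m : {cmonom I}) :
    {cmonom I} :=
  mkcmonom [fsfun i in finsupp m => (m i %/ n)%N | 0%N].

(** The Adams operation, which substitutes x ^ n for each variable x. *)
HB.lock Definition psi (I : choiceType) (n : nat) (f : series I) : series I :=
  fun m => if scalem n (rootm n m) == m then f (rootm n m) else 0.

Arguments scalem {I} n m.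
Arguments rootm {I} n m.
Arguments psi {I} n f.

Section Adams.
Variable I : choiceType.
Implicit Types (f g : series I) (m a b : {cmonom I}).
Local Notation scalem := (@scalem I).
Local Notation rootm := (@rootm I).
Local Notation psi := (@psi I).

Lemma scalemE n m i : scalem n m i = (n * m i)%N.
Proof.
by rewrite scalem.unlock cmE /= fsfun_fun; case: mdomP => // _; rewrite muln0.
Qed.

Lemma rootmE n m i : rootm n m i = (m i %/ n)%N.
Proof.
by rewrite rootm.unlock cmE /= fsfun_fun; case: mdomP => // _; rewrite div0n.
Qed.

Lemma scalemK n : (0 < n)%N -> cancel (scalem n) (rootm n).
Proof. by move=> n0 m; apply/eqP/cmP => i; rewrite rootmE scalemE mulKn. Qed.

Lemma scalem_inj n : (0 < n)%N -> injective (scalem n).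
Proof. by move=> n0; apply: can_inj (scalemK n0). Qed.

Lemma scalemM n a b : scalem n (mmul a b) = mmul (scalem n a) (scalem n b).
Proof. by apply/eqP/cmP => i; rewrite cmM !scalemE cmM mulnDr. Qed.

Lemma scalemD n n' a : scalem (n + n') a = mmul (scalem n a) (scalem n' a).
Proof. by apply/eqP/cmP => i; rewrite cmM !scalemE mulnDl. Qed.

Lemma scalemA n n' a : scalem n (scalem n' a) = scalem (n * n') a.
Proof. by apply/eqP/cmP => i; rewrite !scalemE mulnA. Qed.

Lemma scalem0 a : scalem 0 a = mone.
Proof. by apply/eqP/cmP => i; rewrite scalemE cm1. Qed.

Lemma scalem1 n : scalem n mone = mone.
Proof. by apply/eqP/cmP => i; rewrite scalemE cm1 muln0. Qed.

Lemma scale1m a : scalem 1 a = a.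
Proof. by apply/eqP/cmP => i; rewrite scalemE mul1n. Qed.

Lemma scalemP n m :
  reflect (exists a, m = scalem n a) (scalem n (rootm n m) == m).
Proof.
apply: (iffP eqP) => [E|[a ->]]; first by exists (rootm n m).
case: n => [|n]; first by rewrite !scalem0.
by rewrite scalemK.
Qed.

Lemma mdeg_scalem n m : mdeg (scalem n m) = (n * mdeg m)%N.
Proof.
elim: n => [|n IHn]; first by rewrite scalem0 mdeg1.
by rewrite -add1n scalemD mdegM scale1m IHn mulSn.
Qed.

Lemma monomX m n : monom m ^+ n = monom (scalem n m).
Proof.
elim: n => [|n IHn]; first by rewrite scalem0 monom1.
by rewrite exprS {}IHn monomM -add1n scalemD scale1m.
Qed.

Lemma psiE0 n f m : psi n f m =
  if scalem n (rootm n m) == m then f (rootm n m) else 0.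
Proof. by rewrite psi.unlock. Qed.

Lemma psiE n f m : (0 < n)%N -> psi n f (scalem n m) = f m.
Proof. by move=> n0; rewrite !psiE0 scalemK // eqxx. Qed.

Lemma psi_eq0 n f m : (forall a, m <> scalem n a) -> psi n f m = 0.
Proof. by rewrite !psiE0; case: scalemP => // -[a ->] /(_ a). Qed.

Lemma psi_ext n f g : (0 < n)%N -> (forall m, g (scalem n m) = f m) ->
  (forall m, (forall a, m <> scalem n a) -> g m = 0) -> psi n f = g.
Proof.
move=> n0 gf g0; apply/funext => m.
have [/scalemP[a ->]|/scalemP no] := boolP (scalem n (rootm n m) == m).
  by rewrite psiE.
rewrite psi_eq0 ?g0 // => a E; apply: no; by exists a.
Qed.

Lemma psiD n f g : psi n (f + g) = psi n f + psi n g.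
Proof. by apply/funext => m; rewrite addsE !psiE0; case: eqP; rewrite ?addr0. Qed.

Lemma psi0 n : psi n 0 = 0.
Proof. by apply/funext => m; rewrite !psiE0; case: eqP. Qed.

Lemma psiZ n (c : rat) f : psi n (c *: f) = c *: psi n f.
Proof. by apply/funext => m; rewrite scalesE !psiE0; case: eqP; rewrite ?mulr0. Qed.

Lemma psi_sum n (T : Type) (r : seq T) (P : pred T) (F : T -> series I) :
  psi n (\sum_(t <- r | P t) F t) = \sum_(t <- r | P t) psi n (F t).
Proof. exact: (big_morph (psi n) (psiD n) (psi0 n)). Qed.

Lemma psi_monom n a : (0 < n)%N -> psi n (monom a) = monom (scalem n a).
Proof.
move=> n0; apply: psi_ext => // m.
  by rewrite !monomE (inj_eq (scalem_inj n0)).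
by rewrite monomE => ne; case: eqP => // /ne.
Qed.

Lemma psi1 n : (0 < n)%N -> psi n 1 = 1.
Proof. by move=> n0; rewrite -monom1 psi_monom // scalem1. Qed.

Lemma psi_psi n n' f : (0 < n)%N -> (0 < n')%N ->
  psi n (psi n' f) = psi (n * n') f.
Proof.
move=> n0 n'0; apply/esym/psi_ext; rewrite ?muln_gt0 ?n0 // => m.
  by rewrite -scalemA !psiE.
move=> ne; have [[a ea]|no] := pselect (exists a, m = scalem n a); last first.
  by rewrite psi_eq0 // => a ea; apply: no; exists a.
rewrite ea psiE // psi_eq0 // => b eb; apply: (ne b).
by rewrite ea eb scalemA.
Qed.

Lemma psiM n f g : (0 < n)%N -> psi n (f * g) = psi n f * psi n g.
Proof.
move=> n0; apply: psi_ext => // m; last first.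
  move=> ne; apply/eqP; apply: contrapT => /negP /muls_neq0[a [b [abm fa gb]]].
  have root (h : series I) c : psi n h c != 0 -> exists d, c = scalem n d.
    move=> hc; apply: contrapT => no; move/eqP: hc; apply.
    by apply: psi_eq0 => d E; apply: no; exists d.
  have [[a' ea] [b' eb]] := (root _ _ fa, root _ _ gb).
  by apply: (ne (mmul a' b')); rewrite scalemM -ea -eb.
pose r := mdivs m; pose t := undup (map (scalem n) r ++ mdivs (scalem n m)).
have ut : uniq t by exact: undup_uniq.
have tP a b : mmul a b = scalem n m -> a \in t.
  by move=> /mdivsP at0; rewrite mem_undup mem_cat at0 orbT.
(* The terms outside the n-th powers vanish. *)
have st (F : {cmonom I} -> rat) : (forall a, a \in t ->
      (forall d, d \in r -> a <> scalem n d) -> F a = 0) ->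
    \sum_(a <- t) F a = \sum_(a <- r) F (scalem n a).
  move=> F0; rewrite -(big_map (scalem n) predT F).
  rewrite (bigID (mem (map (scalem n) r))) /= [X in _ + X]big1_seq ?addr0.
    rewrite -big_filter; apply: perm_big; apply: uniq_perm.
    - by rewrite filter_uniq.
    - by rewrite map_inj_uniq ?mdivs_uniq //; apply: scalem_inj.
    - move=> a; rewrite mem_filter mem_undup mem_cat.
      by case: (a \in map _ _).
  move=> a /andP[/negP na at0]; apply: F0 => // d dr ad; apply: na.
  by apply/mapP; exists d.
have far (h k : series I) a b : mmul a b = scalem n m ->
    (forall d, d \in r -> a <> scalem n d) -> psi n h a * psi n k b = 0.
  move=> abm no.
  have [[d ed]|nd] := pselect (exists d, a = scalem n d); last first.
    by rewrite psi_eq0 ?mul0r // => d ed; apply: nd; exists d.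
  have [[e ee]|ne] := pselect (exists e, b = scalem n e); last first.
    by rewrite [psi n k b]psi_eq0 ?mulr0 // => e ee; apply: ne; exists e.
  case: (no d) => //; apply: (@mdivsP _ _ _ e); apply: (scalem_inj n0).
  by rewrite scalemM -ed -ee.
rewrite (mulsE _ _ ut tP) mulsEm st; last first.
  move=> a _ no; rewrite big1 // => b _; case: eqP => // abm.
  by rewrite (far f g a b).
apply: eq_bigr => a _; rewrite st; last first.
  move=> b _ no; case: eqP => // abm.
  by rewrite mulrC (far g f b (scalem n a)) // mulmC.
apply: eq_bigr => b _; rewrite !psiE // -scalemM.
by rewrite (inj_eq (scalem_inj n0)).
Qed.

End Adams.


(** * The generating function kappa *)

Definition zsplit : varsplit (option nat) nat :=
  @VarSplit _ _ id id (fun=> erefl) (fun=> erefl).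

Notation zcoef := (coef zsplit).
Notation zsmon := (smon zsplit).
Notation zrest := (rest zsplit).

Lemma zmon_smon n mu : zmon n mu = zsmon n mu.
Proof. by apply/eqP/cmP => i; rewrite zmonE smonE. Qed.

Lemma pleth_qE n P : pleth_q (Posz n) P = zcoef n (kappa P).
Proof. by apply/funext => mu; rewrite coefE -zmon_smon. Qed.

Section Factor.
Variable mu : {cmonom nat}.
(* The monomial z x^mu. *)
Let w : series (option nat) := monom (zsmon 1 mu).

Lemma zsmonX n : scalem n (zsmon 1 mu) = zsmon n (scalem n mu).
Proof.
apply/eqP/cmP => i; rewrite scalemE !smonE.
by case: i => [i|] /=; rewrite ?scalemE // muln1.
Qed.

Lemma zcoef_wX n k : zcoef n (w ^+ k) = if n == k then monom (scalem n mu) else 0.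
Proof.
rewrite /w monomX zsmonX coef_monom.
by case: eqP => [->|].
Qed.

Lemma zcoef_wM n f : zcoef n.+1 (w * f) = monom mu * zcoef n f.
Proof. by rewrite coef_monomM /= subn1. Qed.

Lemma zcoef_wM0 f : zcoef 0 (w * f) = 0.
Proof. by rewrite coef_monomM. Qed.

Lemma zcoef_pow1D n (e c : rat) :
  zcoef n (pow1D (e *: w) c) = (gbinom c n * e ^+ n) *: monom (scalem n mu).
Proof.
apply/funext => nu; rewrite coefE /pow1D /ssum (fsbigTE [fset n]%fset); last first.
  move=> k; rewrite inE => /negPf nk.
  rewrite exprZn !scalesE -(coefE zsplit n) zcoef_wX eq_sym nk.
  by rewrite !mulr0.
by rewrite big_seq_fset1 exprZn !scalesE -(coefE zsplit n) zcoef_wX eqxx mulrA.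
Qed.

Lemma gbinom0 (c : rat) : gbinom c 0 = 1.
Proof. by rewrite /gbinom big_ord0 fact0 divr1. Qed.

Lemma gbinomS (c : rat) n : n.+1%:R * gbinom c n.+1 = (c - n%:R) * gbinom c n.
Proof.
rewrite /gbinom big_ord_recr factS natrM /=.
rewrite invfM; have n0 : n.+1%:R != 0 :> rat by rewrite Num.Theory.pnatr_eq0.
by rewrite [X in _ * X = _]mulrC !mulrA mulfV // mul1r mulrC mulrA mulrAC mulrC mulrA.
Qed.

Lemma euler_pow1D (e c : rat) : (1 + e *: w) * euler None (pow1D (e *: w) c) =
  (c * e) *: (w * pow1D (e *: w) c).
Proof.
apply: (coefP (sp := zsplit)) => n.
rewrite mulrDl mul1r -scalerAl coefD !coefZ.
rewrite coef_euler zcoef_pow1D.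
case: n => [|n]; first by rewrite !zcoef_wM0 !scaler0 scale0r addr0.
rewrite !zcoef_wM coef_euler !zcoef_pow1D.
rewrite -!scalerAr !scalerA -add1n scalemD scale1m monomM -scalerDl add1n.
congr (_ *: _); transitivity (n.+1%:R * gbinom c n.+1 * e ^+ n.+1 +
  e * (n%:R * (gbinom c n * e ^+ n))); first by congr (_ + _); apply: mulrA.
by rewrite gbinomS exprS; ring.
Qed.

(** The series w + w^3 + w^5 + ... *)
Definition oddgeo : series (option nat) := fun m =>
  (odd (m None) && (zrest m == scalem (m None) mu))%:R.

Lemma zcoef_oddgeo n :
  zcoef n oddgeo = if odd n then monom (scalem n mu) else 0.
Proof.
apply/funext => nu; rewrite coefE /oddgeo rest_smon.
rewrite smon_None.
by case: odd; rewrite ?monomE.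
Qed.

Lemma oddgeoE : (1 - w ^+ 2) * oddgeo = w.
Proof.
apply: (coefP (sp := zsplit)) => n; rewrite mulrBl mul1r coefB.
rewrite -{2}[w]expr1 zcoef_wX expr2 -mulrA.
case: n => [|[|n]]; first by rewrite zcoef_wM0 zcoef_oddgeo subr0.
  by rewrite zcoef_wM zcoef_wM0 zcoef_oddgeo mulr0 subr0.
rewrite !zcoef_wM !zcoef_oddgeo /= negbK.
case: odd; last by rewrite !mulr0 subr0.
rewrite !monomM -[n.+2]add1n scalemD -[n.+1]add1n scalemD !scale1m.
exact: subrr.
Qed.

(** The equation f = w^2 f determines the coefficients of f recursively. *)
Lemma oneBw2_cancel f : (1 - w ^+ 2) * f = 0 -> f = 0.
Proof.
rewrite mulrBl mul1r => /eqP; rewrite subr_eq0 expr2 -mulrA => /eqP fE.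
apply: (coefP (sp := zsplit)) => n.
rewrite coef0.
have [k] := ubnP n; elim: k n => // k IHk [|[|n]] nk.
- by rewrite fE zcoef_wM0.
- by rewrite fE zcoef_wM zcoef_wM0 mulr0.
- by rewrite fE !zcoef_wM IHk ?mulr0 //; lia.
Qed.

Definition kfactor (c : rat) : series (option nat) := pow1D w c * pow1D (- w) (- c).

(** As w is of degree one in z, z d/dz acts on series in w as w d/dw, and the
    derivative of log ((1 + w) / (1 - w)) is 2 / (1 - w^2). *)
Lemma euler_kfactor c :
  euler None (kfactor c) = kfactor c * ((2%:R * c) *: oddgeo).
Proof.
apply/eqP; rewrite -subr_eq0; apply/eqP/oneBw2_cancel.
rewrite mulrBr -scalerAr -scalerAr mulrCA oddgeoE /kfactor eulerM.
have := euler_pow1D 1 c; rewrite scale1r mulr1.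
have := euler_pow1D (-1) (- c); rewrite scaleN1r mulrNN mulr1.
set f := pow1D w c; set g := pow1D (- w) (- c).
move: f g (euler None f) (euler None g) => f g ef eg E2 E1.
have -> : (1 - w ^+ 2) * (ef * g + f * eg) =
   (1 - w) * ((1 + w) * ef * g) + (1 + w) * (f * ((1 - w) * eg)) by ring.
have [d dE] : exists d, forall h : series (option nat), c *: h = d * h.
  by exists c%:A => h; rewrite mulr_algl.
by rewrite E1 E2 -scalerA scaler_nat !dE; ring.
Qed.

Lemma zcoef0_kfactor c : zcoef 0 (kfactor c) = 1.
Proof.
have triv (e d : rat) : zcoef 0 (pow1D (e *: w) d) = 1.
  by rewrite zcoef_pow1D gbinom0 expr0 mulr1 scale1r scalem0 monom1.
have := triv 1 c; have := triv (-1) (- c).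
by rewrite coef0M scale1r scaleN1r => -> ->; rewrite mulr1.
Qed.

(** Convergence of the infinite product: the nonconstant terms of the factor
    are multiples of mu. *)
Lemma kfactor_triv c m : (forall b, mmul mu b <> zrest m) -> eqdiv m (kfactor c) 1.
Proof.
move=> no; rewrite -[X in eqdiv _ _ X]mulr1.
have triv (e d : rat) : eqdiv m (pow1D (e *: w) d) 1.
  move=> a b abm; rewrite -(smonK zsplit a) -!(coefE zsplit (a None)).
  rewrite zcoef_pow1D coef1.
  case E: (a None) => [|n].
    by rewrite scalem0 monom1 gbinom0 expr0 mulr1 scale1r eqxx.
  rewrite scalesE monomE; case: eqP => [aE|]; last by rewrite mulr0.
  case: (no (mmul (scalem n mu) (zrest b))).
  rewrite mulmA -{1}[mu]scale1m -scalemD add1n -aE.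
  by rewrite -restM abm.
apply: eqdivM; first by rewrite -[w]scale1r; apply: triv.
by rewrite -scaleN1r; apply: triv.
Qed.

End Factor.

(** ** The differential equation of kappa *)

(** By kfactor_triv, only the factors at the divisors of zrest m matter, so the
    finite products are stationary. *)
Lemma kappaE P (m : {cmonom (option nat)}) (S : {fset {cmonom nat}}) :
    (forall mu b, mmul mu b = zrest m -> mu \in S) ->
  eqdiv m (kappa P) (\prod_(mu <- S) kfactor mu (P mu)).
Proof.
move=> mS a b abm.
have kE : kappa P = sprod (fun mu => kfactor mu (P mu)).
  rewrite /kappa; congr sprod; apply/funext => mu.
  by rewrite zmon_smon.
rewrite kE /sprod.
set v := (\prod_(mu <- S) kfactor mu (P mu)) a.
have stable (S' : {fset {cmonom nat}}) : (S `<=` S')%fset ->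
    (\prod_(mu <- S') kfactor mu (P mu)) a = v.
  move=> SS'; rewrite /v.
  have -> : \prod_(mu <- S') kfactor mu (P mu) =
      (\prod_(mu <- S) kfactor mu (P mu)) *
      (\prod_(mu <- (S' `\` S)%fset) kfactor mu (P mu)).
    rewrite -big_cat; apply: perm_big; apply: uniq_perm.
    - exact: fset_uniq.
    - rewrite cat_uniq !fset_uniq andbT /=; apply/hasPn => mu.
      by rewrite in_fsetD => /andP[].
    - move=> mu; rewrite mem_cat in_fsetD.
      by case: (mu \in S) (fsubsetP SS' mu) => [->|].
  rewrite -[in RHS](mulr1 (\prod_(mu <- S) _)); apply: eqdiv_self.
  apply: eqdivM; first by [].
  apply: eqdiv_prod1 => mu; rewrite in_fsetD => /andP[nS _].
  apply: kfactor_triv => c ac; move/negP: nS; apply.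
  by apply: (mS _ (mmul c (zrest b))); rewrite mulmA ac -restM abm.
apply: xget_unique; first by exists S.
move=> c [S0 /(_ _ (fsubsetUl S0 S))].
by rewrite (stable _ (fsubsetUr S0 S)) => <-.
Qed.

Definition mdivs_fset (mu : {cmonom nat}) : {fset {cmonom nat}} :=
  [fset nu in mdivs mu]%fset.

Lemma kappa_mdivs P m :
  eqdiv m (kappa P) (\prod_(mu <- mdivs_fset (zrest m)) kfactor mu (P mu)).
Proof. by apply: kappaE => mu b mub; rewrite in_fset; apply: mdivsP mub. Qed.

(** Logarithmic derivative of kappa P in z. *)
Definition kappa_log P : series (option nat) := fun m =>
  if odd (m None) then 2%:R * psi (m None) P (zrest m) else 0.

Lemma zcoef_kappa_log n P :
  zcoef n (kappa_log P) = if odd n then 2%:R *: psi n P else 0.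
Proof.
apply/funext => mu; rewrite coefE /kappa_log rest_smon (smon_None zsplit).
by case: odd.
Qed.

Lemma kappa_log_mdivs P m : eqdiv m (kappa_log P)
  (\sum_(mu <- mdivs_fset (zrest m)) (2%:R * P mu) *: oddgeo mu).
Proof.
move=> a b abm; rewrite sumsE /kappa_log.
under eq_bigr do rewrite scalesE /oddgeo.
case: (boolP (odd _)) => [odda|_]; last by rewrite big1 // => mu _; rewrite mulr0.
have a0 : (0 < a None)%N by case: (a None) odda.
rewrite psiE0; case: scalemP => [[nu ea]|no].
  rewrite ea scalemK // (big_fsetD1 nu) /=; last first.
    rewrite in_fset; apply: (@mdivsP _ _ _
      (mmul (scalem (a None).-1 nu) (zrest b))).
    by rewrite mulmA -{1}[nu]scale1m -scalemD add1n prednK // -ea -restM abm.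
  rewrite eqxx mulr1 big_seq big1 ?addr0 // => mu.
  rewrite in_fsetD1 => /andP[/negPf ne _].
  by rewrite (inj_eq (scalem_inj a0)) eq_sym ne mulr0.
rewrite mulr0 big1 // => mu _; case: eqP => [ea|]; last by rewrite mulr0.
by case: no; exists mu.
Qed.

(** The product rule for finite products, read coefficient by coefficient. *)
Lemma euler_kappa P : euler None (kappa P) = kappa P * kappa_log P.
Proof.
apply/funext => m.
rewrite (eqdiv_self (eqdivM (@kappa_mdivs P m) (@kappa_log_mdivs P m))).
rewrite -(euler_prod _ (fun mu => euler_kfactor mu (P mu))) !eulerE.
by rewrite (eqdiv_self (@kappa_mdivs P m)).
Qed.

Lemma kappa_const P : zcoef 0 (kappa P) = 1.
Proof.
apply/funext => nu; rewrite coefE (eqdiv_self (@kappa_mdivs P _)) -coefE.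
apply: (congr1 (fun f : series nat => f nu)).
elim/big_ind: _ => [|f g f1 g1|mu _].
- by rewrite coef01.
- by rewrite coef0M f1 g1 mulr1.
exact: zcoef0_kfactor.
Qed.

(** As H has no constant term, the equation is a recursion that determines the
    coefficients: n F_n = sum_(i < n) F_i H_(n-i). *)
Lemma euler_uniq (F G H : series (option nat)) : zcoef 0 H = 0 ->
  euler None F = F * H -> euler None G = G * H -> zcoef 0 F = zcoef 0 G -> F = G.
Proof.
move=> H0 eF eG F0; apply: (coefP (sp := zsplit)) => n.
have [k] := ubnP n; elim: k n => // k IHk [|n] // nk.
have n0 : n.+1%:R != 0 :> rat by rewrite Num.Theory.pnatr_eq0.
apply: (scalerI n0); rewrite -!(coef_euler zsplit) eF eG !coefM.
rewrite [LHS]big_ord_recr [RHS]big_ord_recr /= subnn H0 !mulr0.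
congr (_ + _).
by apply: eq_bigr => i _; rewrite IHk //; have := ltn_ord i; lia.
Qed.

Lemma kappa_log0 P : zcoef 0 (kappa_log P) = 0.
Proof. by rewrite zcoef_kappa_log. Qed.

Lemma kappa_logD P P' : kappa_log (P + P') = kappa_log P + kappa_log P'.
Proof.
apply: (coefP (sp := zsplit)) => n; rewrite coefD !zcoef_kappa_log.
by case: odd; rewrite ?addr0 // psiD scalerDr.
Qed.

Lemma kappaD P P' : kappa (P + P') = kappa P * kappa P'.
Proof.
apply: (@euler_uniq _ _ (kappa_log (P + P'))); first exact: kappa_log0.
- exact: euler_kappa.
- by rewrite eulerM !euler_kappa kappa_logD; ring.
- by rewrite coef0M !kappa_const mulr1.
Qed.

Lemma kappa_log_zero : kappa_log 0 = 0.
Proof.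
apply: (coefP (sp := zsplit)) => n.
by rewrite zcoef_kappa_log psi0 scaler0 coef0 if_same.
Qed.

Lemma kappa0 : kappa 0 = 1.
Proof.
apply: (@euler_uniq _ _ (kappa_log 0) (kappa_log0 0) (euler_kappa 0)).
- by rewrite kappa_log_zero mulr0 euler1.
- by rewrite kappa_const coef01.
Qed.

(** The substitution of -z for z. *)
Definition zneg (F : series (option nat)) : series (option nat) :=
  fun m => (-1) ^+ (m None) * F m.

Lemma zcoef_zneg n F : zcoef n (zneg F) = (-1) ^+ n *: zcoef n F.
Proof.
by apply/funext => mu; rewrite scalesE !coefE /zneg (smon_None zsplit).
Qed.

Lemma znegM F G : zneg (F * G) = zneg F * zneg G.
Proof.
apply: (coefP (sp := zsplit)) => n; rewrite zcoef_zneg !coefM scaler_sumr.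
apply: eq_bigr => i _; rewrite !zcoef_zneg -scalerAl -scalerAr scalerA -exprD.
by rewrite subnKC // -ltnS.
Qed.

(** The logarithmic derivative being odd in z, that of the product is 0. *)
Lemma kappa_neg P : kappa P * zneg (kappa P) = 1.
Proof.
apply: (@euler_uniq _ _ 0); first by rewrite coef0.
- rewrite mulr0 eulerM euler_kappa.
  have -> : euler None (zneg (kappa P)) = zneg (euler None (kappa P)).
    by apply/funext => m; rewrite eulerE /zneg eulerE mulrCA.
  rewrite euler_kappa znegM.
  have -> : zneg (kappa_log P) = - kappa_log P.
    apply: (coefP (sp := zsplit)) => n; rewrite zcoef_zneg -scaleN1r coefZ.
    rewrite zcoef_kappa_log -signr_odd; case: odd => /=; last by rewrite !scaler0.
    by rewrite expr1.
  by ring.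
- by rewrite mulr0 euler1.
- by rewrite coef0M zcoef_zneg kappa_const coef01 expr0 scale1r mulr1.
Qed.

(** ** The coefficients of kappa *)

Lemma pleth_q0 P : pleth_q 0 P = 1.
Proof. by rewrite (pleth_qE 0) kappa_const. Qed.

Lemma pleth_q_rec (n : nat) P : n.+1%:R *: pleth_q n.+1 P =
  \sum_(i < n.+1) pleth_q i P *
    (if odd (n.+1 - i) then 2%:R *: psi (n.+1 - i) P else 0).
Proof.
rewrite pleth_qE -(coef_euler zsplit) euler_kappa coefM big_ord_recr /= subnn.
rewrite kappa_log0 mulr0 addr0; apply: eq_bigr => i _.
by rewrite zcoef_kappa_log pleth_qE.
Qed.

Lemma pleth_qD (n : nat) P P' : pleth_q n (P + P') =
  \sum_(i < n.+1) pleth_q i P * pleth_q (n - i)%N P'.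
Proof.
by rewrite pleth_qE kappaD coefM; apply: eq_bigr => i _; rewrite !pleth_qE.
Qed.

Lemma pleth_q_zero (n : nat) : pleth_q n 0 = (n == 0%N)%:R.
Proof. by rewrite pleth_qE kappa0 coef1. Qed.

Lemma pleth_q_neg (n : nat) P :
  \sum_(i < n.+1) (-1) ^+ (n - i) *: (pleth_q i P * pleth_q (n - i)%N P) =
  (n == 0%N)%:R.
Proof.
rewrite -(coef1 zsplit) -(kappa_neg P) coefM; apply: eq_bigr => i _.
by rewrite zcoef_zneg !pleth_qE -scalerAr.
Qed.

(** The special values of pleth_q below all come from Newton's recursion. *)
Lemma pleth_q_uniq P (c : nat -> series nat) : c 0%N = 1 ->
    (forall n, n.+1%:R *: c n.+1 = \sum_(i < n.+1) c i *
      (if odd (n.+1 - i) then 2%:R *: psi (n.+1 - i) P else 0)) ->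
  forall n : nat, pleth_q n P = c n.
Proof.
move=> c0 crec n; have [k] := ubnP n; elim: k n => // k IHk [|n] nk.
  by rewrite pleth_q0 c0.
have n0 : n.+1%:R != 0 :> rat by rewrite Num.Theory.pnatr_eq0.
apply: (scalerI n0); rewrite pleth_q_rec crec; apply: eq_bigr => i _.
by rewrite IHk //; have := ltn_ord i; lia.
Qed.

(** * Homogeneous series *)

Definition homog (I : choiceType) (d : nat) (f : series I) :=
  forall m, f m != 0 -> mdeg m = d.

Section Homog.
Variable I : choiceType.
Implicit Types (f g : series I) (d e : nat).

Lemma homog0 d : homog d (0 : series I).
Proof. by move=> m; rewrite eqxx. Qed.

Lemma homogD d f g : homog d f -> homog d g -> homog d (f + g).
Proof.
move=> fd gd m; rewrite addsE => fg; apply: contrapT => nd.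
have [f0 g0] : f m = 0 /\ g m = 0.
  by split; apply/eqP; apply: contrapT => /negP h; apply: nd; [apply: fd|apply: gd].
by rewrite f0 g0 addr0 eqxx in fg.
Qed.

Lemma homogZ d (c : rat) f : homog d f -> homog d (c *: f).
Proof.
by move=> fd m; rewrite scalesE mulf_eq0 negb_or => /andP[_ /fd].
Qed.

Lemma homog_sum d (T : Type) (r : seq T) (P : pred T) (F : T -> series I) :
  (forall t, P t -> homog d (F t)) -> homog d (\sum_(t <- r | P t) F t).
Proof. by move=> Fd; apply: big_ind => //; apply: homogD. Qed.

Lemma homogM d e f g : homog d f -> homog e g -> homog (d + e) (f * g).
Proof.
by move=> fd ge m /muls_neq0[a [b [<- /fd <- /ge <-]]]; rewrite mdegM.
Qed.

Lemma homog_psi d n f : homog d f -> homog (n * d) (psi n f).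
Proof.
move=> fd m; rewrite psiE0; case: (scalem _ _ =P m) => [e fm|_]; last by rewrite eqxx.
by rewrite -e mdeg_scalem (fd _ fm).
Qed.

Lemma homog1 : homog 0 (1 : series I).
Proof. by move=> m; rewrite onesE; case: (m =P mone) => [-> _|]; rewrite ?mdeg1 ?eqxx. Qed.

Lemma homog_eq0 d f m : homog d f -> mdeg m <> d -> f m = 0.
Proof. by move=> fd nd; apply/eqP; apply: contrapT => /negP /fd. Qed.

End Homog.

Lemma homog_pleth_q d (n : nat) P : homog d P -> homog (n * d) (pleth_q n P).
Proof.
move=> Pd; have [k] := ubnP n; elim: k n => // k IHk [|n] nk.
  by rewrite pleth_q0; apply: homog1.
have n0 : n.+1%:R != 0 :> rat by rewrite Num.Theory.pnatr_eq0.
rewrite -[pleth_q _ _](scalerK n0) pleth_q_rec; apply: homogZ.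
apply: homog_sum => i _.
have -> : (n.+1 * d = i * d + (n.+1 - i) * d)%N.
  by rewrite -mulnDl subnKC // ltnW.
apply: homogM; first by apply: IHk; have := ltn_ord i; lia.
by case: odd; [apply/homogZ/homog_psi | apply: homog0].
Qed.

(** * Adding a variable to the alphabet *)

Lemma mdeg_smon (I J : choiceType) (sp : varsplit I J) n mu :
  mdeg (smon sp n mu) = (n + mdeg mu)%N.
Proof.
rewrite (mdegEw (d := (enc sp None |` [fset enc sp (Some j) | j in finsupp mu])%fset)).
  rewrite big_fsetU1 /=; last first.
    apply/imfsetP => -[j _ /(congr1 (dec sp))]; by rewrite !encK.
  rewrite smon_None mdegE big_imfset /=.
    by congr (_ + _)%N; apply: eq_bigr => j _; rewrite smonE encK.
  by move=> i j _ _ /(congr1 (dec sp)); rewrite !encK => -[].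
apply/fsubsetP => i; rewrite -cmE_neq0 smonE !inE.
case E: (dec sp i) => [j|] ni; last by rewrite -[i](decK sp) E eqxx.
apply/orP; right; apply/imfsetP; exists j; last by rewrite -E decK.
by rewrite -cmE_neq0.
Qed.

Lemma scalem_smon (I J : choiceType) (sp : varsplit I J) k n mu :
  scalem k (smon sp n mu) = smon sp (k * n) (scalem k mu).
Proof.
apply/eqP/cmP => i; rewrite scalemE !smonE.
by case: (dec sp i) => [j|] //; rewrite scalemE.
Qed.

Lemma psi_embed (I J : choiceType) (sp : varsplit I J) n F : (0 < n)%N ->
  psi n (embed sp F) = embed sp (psi n F).
Proof.
move=> n0; apply: psi_ext => // m.
  rewrite -[m](smonK sp) scalem_smon !embedE !smon_None !rest_smon psiE //.
  by rewrite muln_eq0 -[n == _]negbK -lt0n n0.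
move=> no; rewrite embedE; case: eqP => // m0.
apply: psi_eq0 => a ea; apply: (no (smon sp 0 a)).
by rewrite scalem_smon muln0 -ea -m0 smonK.
Qed.

Definition aenc (o : option nat) : nat := if o is Some i then i.+1 else 0%N.
Definition adec (i : nat) : option nat := if i is i'.+1 then Some i' else None.

Lemma adecK : cancel adec aenc. Proof. by case. Qed.
Lemma aencK : cancel aenc adec. Proof. by case. Qed.

(** The first letter of the alphabet is singled out, the remaining ones being
    renumbered: series in a_0, a_1, ... are at the same time series in a new
    variable u = a_0 and an alphabet. Then shift is the inclusion of the series
    in the alphabet, and acoef n extracts the coefficient of u^n. *)
Definition asplit : varsplit nat nat := VarSplit adecK aencK.

Notation acoef := (coef asplit).
Notation shift := (embed asplit).

Definition u_mon (n : nat) : {cmonom nat} := smon asplit n mone.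

Lemma alphabetE m : alphabet m = (mdeg m == 1%N)%:R.
Proof.
rewrite /alphabet /ssum; case: eqP => [m1|nm].
  have [i mi] : exists i, m i != 0%N.
    apply: contrapT => no; have : m = mone.
      apply/eqP/cmP => i; rewrite cm1; apply/eqP; apply: contrapT => /negP mi.
      by apply: no; exists i.
    by move=> m0; rewrite m0 mdeg1 in m1.
  have dE j : divcm m (ucm i) j = (m j - (i == j))%N.
    rewrite /divcm cmE /= fsfun_fun cmU.
    by case: mdomP => // _; rewrite sub0n.
  have mE : m = mmul (ucm i) (divcm m (ucm i)).
    apply/eqP/cmP => j; rewrite cmM dE cmU; case: eqP => [<-|_].
      by rewrite subnKC // lt0n.
    by rewrite subn0.
  have : mdeg (divcm m (ucm i)) = 0%N.
    by move: m1; rewrite {1}mE mdegM mdegU => -[].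
  move/mdeg_eq0I => d0; rewrite d0 mulm1 in mE.
  rewrite (fsbigTE [fset i]%fset) ?big_seq_fset1 ?monomE ?mE ?eqxx //.
  move=> j; rewrite in_fset1 monomE => /negPf ji; case: eqP => //.
  move/(congr1 (fun c : {cmonom nat} => c j)); rewrite !cmU eqxx.
  by rewrite eq_sym ji.
rewrite fsbig1 // => i _; rewrite monomE; case: eqP => // mi.
by case: nm; rewrite mi mdegU.
Qed.

Lemma homog_alphabet : homog 1 alphabet.
Proof. by move=> m; rewrite alphabetE; case: (mdeg m =P 1%N); rewrite ?eqxx. Qed.

Lemma homog_q (n : nat) : homog n (q n).
Proof. by have := @homog_pleth_q 1 n _ homog_alphabet; rewrite muln1. Qed.

Lemma alphabet_shift : alphabet = monom (u_mon 1) + shift alphabet.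
Proof.
apply: (coefP (sp := asplit)) => n; rewrite coefD coef_embed /u_mon coef_monom.
apply/funext => mu; rewrite addsE coefE alphabetE mdeg_smon.
case: n => [|[|n]] /=.
- by rewrite alphabetE add0r.
- by rewrite addr0 monomE add1n eqSS mdeg_eq0.
- by rewrite addr0.
Qed.

Lemma pleth_q_shift (n : nat) P : pleth_q n (shift P) = shift (pleth_q n P).
Proof.
apply: (pleth_q_uniq (c := fun n : nat => shift (pleth_q n P))).
  by rewrite pleth_q0 embed1.
move=> {}n; rewrite -embedZ pleth_q_rec embed_sum; apply: eq_bigr => i _.
rewrite embedM; congr (_ * _); case: odd; last by rewrite embed0.
by rewrite psi_embed ?embedZ // subn_gt0.
Qed.

(** A monomial a only rescales the variable: kappa_z(a P) = kappa_(z a)(P), z a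
    being a monomial. *)
Lemma pleth_q_monomM (n : nat) a P :
  pleth_q n (monom a * P) = monom (scalem n a) * pleth_q n P.
Proof.
apply: (pleth_q_uniq (c := fun n : nat => monom (scalem n a) * pleth_q n P)).
  by rewrite pleth_q0 scalem0 monom1 mulr1.
move=> {}n; rewrite scalerAr pleth_q_rec [LHS]mulr_sumr.
apply: eq_bigr => i _.
have ni : (0 < n.+1 - i)%N by rewrite subn_gt0.
rewrite psiM // psi_monom // -{1}(subnKC (ltnW (ltn_ord i))) scalemD -monomM.
case: odd => /=; last by rewrite !mulr0.
rewrite -!scalerAr; congr (_ *: _).
move: (monom _) (monom _) (pleth_q _ _) (psi _ _) => x y z t; ring.
Qed.

(** Coefficients of (1 + z) / (1 - z). *)
Definition kcoef (n : nat) : nat := if n == 0%N then 1 else 2.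

(** Newton's recursion for the alphabet with the single monomial 1. *)
Lemma kcoef_sum n : (\sum_(i < n.+1) kcoef i * odd (n.+1 - i) = n.+1)%N.
Proof.
have tot k : (\sum_(i < k.+1) kcoef i = k.*2.+1)%N.
  elim: k => [|k IHk]; first by rewrite big_ord1.
  by rewrite big_ord_recr IHk /kcoef /=; lia.
elim: n => [|n IHn]; first by rewrite big_ord_recr big_ord0.
suff : (\sum_(i < n.+2) kcoef i * odd (n.+2 - i) +
    \sum_(i < n.+1) kcoef i * odd (n.+1 - i) = n.*2.+1 + 2)%N.
  by rewrite IHn; lia.
rewrite big_ord_recr /= subSnn addnAC -big_split /= -tot; congr (_ + _)%N.
apply: eq_bigr => i _; rewrite -mulnDr subSn 1?ltnW //=.
by case: odd; rewrite ?muln1.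
Qed.

Lemma pleth_q_one (n : nat) : pleth_q n 1 = (kcoef n)%:R.
Proof.
apply: (pleth_q_uniq (c := fun n : nat => (kcoef n)%:R)) => // {}n.
rewrite -{1}(kcoef_sum n) natr_sum scaler_suml; apply: eq_bigr => i _.
rewrite psi1 ?subn_gt0 //; case: odd; rewrite /= ?muln1 ?muln0 ?scale0r ?mulr0 //.
by rewrite !scaler_nat mulr_natr -!mulrnA mulnC.
Qed.

(** This is kappa_z(u, A) = (1 + z u) / (1 - z u) kappa_z(A). *)
Lemma acoef_q j (n : nat) :
  acoef j (q n) = if (j <= n)%N then (kcoef j)%:R *: q (n - j)%N else 0.
Proof.
rewrite {1}/q alphabet_shift pleth_qD coef_sum.
have E (i : 'I_n.+1) : true -> acoef j (pleth_q i (monom (u_mon 1)) *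
    pleth_q (n - i)%N (shift alphabet)) =
    if (i == j :> nat) then (kcoef j)%:R *: q (n - j)%N else 0.
  rewrite pleth_q_shift -[monom _]mulr1 pleth_q_monomM pleth_q_one.
  rewrite /u_mon scalem_smon scalem1 muln1 mulr_natr mulrC mulrnAr -scaler_nat.
  rewrite coefZ coef_embedM -[monom _]mulr1 coef_monomM monom1 mul1r => _.
  rewrite coef1 subn_eq0; case: (ltngtP i j) => ij.
  - by rewrite mulr0 scaler0.
  - by rewrite mulr0 scaler0.
  by rewrite mulr1 ij.
rewrite (eq_bigr _ E) -big_mkcond /=; case: leqP => jn.
  by rewrite (big_pred1 (Ordinal (jn : (j < n.+1)%N))).
by rewrite big1 // => i /eqP ij; have := ltn_ord i; lia.
Qed.

Lemma q0 : q 0 = 1. Proof. exact: pleth_q0. Qed.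

(** (1 - z u) kappa_z(u, A) = (1 + z u) kappa_z(A), coefficient by coefficient. *)
Lemma q_shiftS (n : nat) :
  q n.+1 - shift (q n.+1) = monom (u_mon 1) * (q n + shift (q n)).
Proof.
apply: (coefP (sp := asplit)) => j.
rewrite coefB coef_embed /u_mon coef_monomM monom1 mul1r acoef_q.
case: j => [|[|j]] /=.
- by rewrite subn0 scale1r subrr.
- by rewrite subr0 coefD coef_embed acoef_q !subn0 subn1 /= !scaler_nat mulr1n.
- rewrite subr0 coefD coef_embed addr0 acoef_q subn1 /= !ltnS.
  by case: leqP => // jn; rewrite !subSS.
Qed.

Lemma q_neg_sum (n : nat) :
  \sum_(i < n.+1) (-1) ^+ i *: (q i * q (n - i)%N) = (n == 0%N)%:R.
Proof.
rewrite -(pleth_q_neg n alphabet) (reindex_inj rev_ord_inj) /=.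
apply: eq_bigr => i _; have ni : (i <= n)%N by rewrite -ltnS.
by rewrite subSS (subKn ni); congr (_ *: _); apply: mulrC.
Qed.

(** * The two-row functions *)

Lemma Q2E (r s : nat) : Q2 r s = q r * q s +
  (\sum_(i < s) (-1) ^+ i.+1 * (q (r + i.+1)%N * q (s - i.+1)%N)) *+ 2.
Proof.
rewrite /Q2 big_add1 /= big_mkord; congr (_ + _ *+ 2).
apply: eq_bigr => i _; congr (_ * (_ * _)).
by rewrite /= -subzn.
Qed.

Opaque Q2.

Lemma Q2_0 (r : nat) : Q2 r 0 = q r.
Proof. by rewrite (Q2E r 0) big_ord0 mul0rn addr0 q0 mulr1. Qed.

Lemma Q2_rec (r s : nat) :
  Q2 r s.+1 = q r * q s.+1 - q r.+1 * q s - Q2 r.+1 s.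
Proof.
rewrite (Q2E r s.+1) (Q2E r.+1 s) big_ord_recl /= addn1 subn1 /=.
have -> : \sum_(i < s) (-1) ^+ (bump 0 i).+1 *
    (q (r + (bump 0 i).+1)%N * q (s.+1 - (bump 0 i).+1)%N) =
    - \sum_(i < s) (-1) ^+ i.+1 * (q (r.+1 + i.+1)%N * q (s - i.+1)%N).
  rewrite -sumrN; apply: eq_bigr => i _.
  rewrite /bump /= add1n subSS !addnS addSn exprS mulN1r -mulNr.
  by [].
move: (q r) (q s.+1) (q r.+1) (q s) (\sum_(i < s) _) => x y z t w.
by rewrite expr1; ring.
Qed.

(** In generating functions, this is the identity
    f(x, y) w(x) w(y) = f(x, y) + w(x) - w(y), for f(x, y) = (x - y) / (x + y)
    and w(x) = (1 + x u) / (1 - x u). The proof is an induction on s: by Q2_rec,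
    the sum Q_(r, s + 1) + Q_(r + 1, s) is quadratic in the q_n, and q_shiftS
    gives its dependence on u. *)
Lemma Q2_shift (r s : nat) :
  Q2 r s = shift (Q2 r s) + q r * shift (q s) - shift (q r) * q s.
Proof.
elim: s r => [|s IHs] r.
  by rewrite Q2_0 q0 embed1 !mulr1; move: (q r) (shift _) => x y; ring.
rewrite !Q2_rec 2!embedD 2!embedN 2!embedM.
have qE n : q (n.+1 : nat) = shift (q n.+1) + monom (u_mon 1) * (q n + shift (q n)).
  by rewrite -q_shiftS addrC subrK.
move: (qE s) (qE r) (IHs r.+1); move: (shift (q s.+1)) (shift (q r.+1)).
move: (Q2 _ _) (shift (Q2 _ _)) (shift (q s)) (shift (q r)) (monom _) => Q' Q'' ps pr u.
move: (q s.+1) (q r.+1) (q s) (q r) => qs1 qr1 qs qr ps1 pr1 -> -> ->; ring.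
Qed.

Lemma homog_Q2 (r s : nat) : homog (r + s) (Q2 r s).
Proof.
elim: s r => [|s IHs] r; first by rewrite Q2_0 addn0; apply: homog_q.
rewrite Q2_rec -!scaleN1r; apply: homogD; last first.
  by rewrite addnS -addSn; apply/homogZ/IHs.
apply: homogD; first by apply: homogM; apply: homog_q.
by rewrite addnS -addSn; apply/homogZ/homogM; apply: homog_q.
Qed.

(** Such a series is free of a_0, hence, by renumbering, of every letter. *)
Lemma shift_fixed d f : homog d f -> (0 < d)%N -> f = shift f -> f = 0.
Proof.
move=> fd d0 fE; apply/funext => m; apply/eqP; apply: contrapT => /negP fm.
have fm0 i (a : {cmonom nat}) : f a != 0 -> a i = 0%N.
  elim: i a => [|i IHi] a; rewrite fE embedE /=.
    by case: (a 0%N =P 0%N) => // _; rewrite eqxx.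
  case: (a 0%N =P 0%N) => [_|_]; last by rewrite eqxx.
  by move=> /IHi; rewrite restE.
have m1 : m = mone by apply/eqP/cmP => i; rewrite cm1 fm0.
by move: (fd _ fm) d0 => <-; rewrite m1 mdeg1.
Qed.

(** In the case r = s, the two perturbation terms of Q2_shift cancel. *)
Lemma Q2_diag (n : nat) : (0 < n)%N -> Q2 n n = 0.
Proof.
move=> n0; apply: (shift_fixed (@homog_Q2 n n)); first by rewrite addn_gt0 n0.
by rewrite {1}Q2_shift mulrC addrK.
Qed.

(** * The operator D_k *)

(** The coefficient of u^k in kappa_(-1/u)(A) f(u, A); by Dop_Dk, this is D_k f
    for f in Gamma. The sum over r is truncated at the degree of m because q_r
    is homogeneous of degree r. *)
Definition Dk (k : nat) (f : series nat) : series nat := fun m =>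
  \sum_(r < (mdeg m).+1) ((-1) ^+ r *: (q r * acoef (k + r) f)) m.

Lemma Dk_eqdiv k f m N : (mdeg m < N)%N ->
  eqdiv m (Dk k f) (\sum_(r < N) (-1) ^+ r *: (q r * acoef (k + r) f)).
Proof.
move=> mN a b abm; rewrite sumsE /Dk.
have aN : ((mdeg a).+1 <= N)%N.
  by apply: leq_trans mN; rewrite -abm mdegM ltnS leq_addr.
rewrite (big_ord_widen N (fun r => ((-1) ^+ r *: (q r * acoef (k + r) f)) a)) //.
rewrite big_mkcond; apply: eq_bigr => r _; case: ltnP => // ar.
rewrite scalesE; apply/esym/eqP; rewrite mulf_eq0; apply/orP; right.
apply: contrapT => /negP /muls_neq0[c [d [cda qc _]]].
move: ar; rewrite -cda mdegM (homog_q qc) ltnNge.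
by rewrite leq_addr.
Qed.

Lemma DkE k f m N : (mdeg m < N)%N ->
  Dk k f m = \sum_(r < N) ((-1) ^+ r *: (q r * acoef (k + r) f)) m.
Proof. by move=> mN; rewrite (eqdiv_self (Dk_eqdiv k f mN)) sumsE. Qed.

Lemma Dk_linear k (c : rat) f g : Dk k (c *: f + g) = c *: Dk k f + Dk k g.
Proof.
apply/funext => m; rewrite addsE scalesE /Dk mulr_sumr -big_split.
apply: eq_bigr => r _; rewrite coefD coefZ mulrDr scalerDr addsE -scalerAr.
by rewrite !scalesE mulrCA.
Qed.

Lemma Dk_add k f g : Dk k (f + g) = Dk k f + Dk k g.
Proof. by have := Dk_linear k 1 f g; rewrite !scale1r. Qed.

Lemma Dk_0 k : Dk k 0 = 0.
Proof.
apply/funext => m; rewrite /Dk big1 // => r _.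
by rewrite coef0 mulr0 scaler0.
Qed.

Lemma Dk_sum k (T : Type) (r : seq T) (P : pred T) (F : T -> series nat) :
  Dk k (\sum_(t <- r | P t) F t) = \sum_(t <- r | P t) Dk k (F t).
Proof. exact: (big_morph (Dk k) (Dk_add k) (Dk_0 k)). Qed.

(** A factor free of u can be taken out of every coefficient of u^n. *)
Lemma Dk_shiftM k f g : Dk k (f * shift g) = Dk k f * g.
Proof.
apply/funext => m; rewrite (DkE _ _ (ltnSn (mdeg m))).
rewrite (eqdiv_self (eqdivM (Dk_eqdiv k f (ltnSn (mdeg m))) (fun _ _ _ => erefl))).
rewrite mulr_suml sumsE; apply: eq_bigr => r _.
by rewrite [f * _]mulrC coef_embedM -scalerAl -mulrA [g * _]mulrC.
Qed.

Lemma Dk_1 k : (0 < k)%N -> Dk k 1 = 0.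
Proof.
move=> k0; apply/funext => m; rewrite /Dk big1 // => r _.
by rewrite coef1 addn_eq0 eqn0Ngt k0 /= mulr0 scaler0.
Qed.

(** The relation q(z) q(-z) = 1 makes all terms cancel unless n = k. *)
Lemma Dk_q k (n : nat) : (0 < k)%N -> Dk k (q n) = (2 * (n == k))%:R.
Proof.
move=> k0; apply/funext => m.
pose N := (maxn (mdeg m) n).+1.
have mN : (mdeg m < N)%N by rewrite ltnS leq_maxl.
rewrite (eqdiv_self (Dk_eqdiv k (q n) mN)); apply: (congr1 (fun f : series nat => f m)).
have E r : acoef (k + r) (q n) =
    if (k + r <= n)%N then 2%:R *: q (n - k - r)%N else 0.
  by rewrite acoef_q /kcoef addn_eq0 eqn0Ngt k0 subnDA.
case: (leqP k n) => [kn|nk]; last first.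
  rewrite (ltn_eqF nk) muln0 mulr0n big1 // => r _; rewrite E leqNgt.
  by rewrite (leq_trans nk (leq_addr _ _)) mulr0 scaler0.
have nN : ((n - k).+1 <= N)%N.
  by rewrite ltnS (leq_trans (leq_subr _ _)) // leq_maxr.
transitivity (2%:R *: \sum_(r < (n - k).+1)
    (-1) ^+ r *: (q r * q (n - k - r)%N)).
  rewrite (big_ord_widen N (fun r => (-1) ^+ r *: (q r * q (n - k - r)%N))) //.
  rewrite [X in _ = _ *: X]big_mkcond scaler_sumr; apply: eq_bigr => r _.
  rewrite E ltnS -leq_subRL //; case: ifP => _; last first.
    by rewrite mulr0 !scaler0.
  by rewrite -scalerAr scalerA mulrC -scalerA.
by rewrite q_neg_sum scaler_nat subn_eq0 eqn_leq kn andbT -mulrnA mulnC.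
Qed.

(** * Pfaffians *)

Lemma algQ_eq0 (V : lmodType rat) (x : V) : x = - x -> x = 0.
Proof.
move=> /eqP; rewrite -subr_eq0 opprK -mulr2n -scaler_nat scaler_eq0.
by rewrite Num.Theory.pnatr_eq0 => /eqP.
Qed.

Lemma lift_perm_onto m (s : 'S_m.+1) : s ord_max = ord_max ->
  exists t, s = lift_perm ord_max ord_max t.
Proof.
move=> sm; have ex k : exists l, s (lift ord_max k) == lift ord_max l.
  have : ord_max != s (lift ord_max k).
    by rewrite -{1}sm (inj_eq perm_inj) neq_lift.
  by case/unlift_some => l sl _; exists l; rewrite sl.
pose low k := xchoose (ex k).
have lowE k : s (lift ord_max k) = lift ord_max (low k).
  exact/eqP/(xchooseP (ex k)).
have low_inj : injective low.
  move=> k l /(congr1 (lift ord_max)); rewrite -!lowE => /perm_inj.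
  exact: lift_inj.
exists (perm low_inj); apply/permP => i.
case: (unliftP ord_max i) => [k ->|->]; last by rewrite lift_perm_id.
by rewrite lift_perm_lift permE lowE.
Qed.

Lemma sum_perm_fix (V : nmodType) m (F : 'S_m.+1 -> V) :
  \sum_(s : 'S_m.+1 | s ord_max == ord_max) F s =
  \sum_s F (lift_perm ord_max ord_max s).
Proof.
pose L (t : 'S_m) : 'S_m.+1 := lift_perm ord_max ord_max t.
have L_inj : {in [set: 'S_m]%SET &, injective L}.
  move=> s t _ _ /permP st; apply/permP => k; apply: (@lift_inj _ ord_max).
  by have := st (lift ord_max k); rewrite !lift_perm_lift.
transitivity (\sum_(s in L @: [set: 'S_m]%SET) F s); last first.
  by rewrite (big_imset _ L_inj); apply: eq_bigl => s; rewrite finset.in_setT.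
apply: eq_bigl => s; apply/eqP/imsetP => [/lift_perm_onto[t ->]|[t _ ->]].
  by exists t; rewrite ?finset.in_setT.
exact: lift_perm_id.
Qed.

Section Pfaffian.
Variable R : comAlgType rat.

Definition skew N (M : 'M[R]_N) :=
  (forall x y, M y x = - M x y) /\ (forall x, M x x = 0).

(** The i-th column follows the i-th row, so that skewness is preserved. *)
Definition rowrep N (i : 'I_N) (v : 'I_N -> R) (M : 'M[R]_N) : 'M[R]_N :=
  \matrix_(x, y) if x == i then (if y == i then 0 else v y)
                 else if y == i then - v x else M x y.

Definition epos n (i : 'I_n) : 'I_(n.*2) := Ordinal (ltn_double_even i).
Definition opos n (i : 'I_n) : 'I_(n.*2) := Ordinal (ltn_double_odd i).

Definition pfterm n (M : 'M[R]_(n.*2)) (s : 'S_(n.*2)) : R :=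
  (-1) ^+ s * \prod_(i < n) M (s (epos i)) (s (opos i)).

Definition pfsum n (M : 'M[R]_(n.*2)) : R := \sum_s pfterm M s.

Lemma pfaffianE n (M : 'M[R]_(n.*2)) :
  pfaffian M = ((2 ^ n * n`!)%:R^-1 : rat) *: pfsum M.
Proof. by []. Qed.

Lemma epos_inj n : injective (@epos n).
Proof. by move=> i j /(congr1 val) /= /double_inj /val_inj. Qed.

Lemma opos_inj n : injective (@opos n).
Proof. by move=> i j /(congr1 val) [] /double_inj /val_inj. Qed.

Lemma epos_opos n (i j : 'I_n) : (epos i == opos j) = false.
Proof.
apply/eqP => /(congr1 (fun x : 'I_(n.*2) => odd x)) /=.
by rewrite !odd_double.
Qed.

Lemma opos_epos n (i j : 'I_n) : (opos i == epos j) = false.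
Proof. by rewrite eq_sym epos_opos. Qed.

Lemma posP n (p : 'I_(n.*2)) :
  (exists i : 'I_n, p = epos i) \/ (exists i : 'I_n, p = opos i).
Proof.
have pn : (p./2 < n)%N by have := ltn_ord p; lia.
case E: (odd p); [right|left]; exists (Ordinal pn); apply/val_inj => /=.
  by rewrite -[LHS]odd_double_half E.
by rewrite -[LHS]odd_double_half E.
Qed.

Lemma pfaffian_perm n (M : 'M[R]_(n.*2)) (t : 'S_(n.*2)) :
  pfaffian (\matrix_(x, y) M (t x) (t y)) = (-1) ^+ t * pfaffian M.
Proof.
rewrite !pfaffianE -scalerAr; congr (_ *: _).
rewrite /pfsum [in RHS](reindex_inj (mulIg t)) mulr_sumr; apply: eq_bigr => s _.
rewrite /pfterm mulrA odd_permM signr_addb mulrCA -signr_addb addbb mulr1.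
by congr (_ * _); apply: eq_bigr => i _; rewrite mxE !permM.
Qed.

Lemma pfaffian_rowrep_linear n (M : 'M[R]_(n.*2)) i (c : R) v w :
  pfaffian (rowrep i (fun y => c * v y + w y) M) =
  c * pfaffian (rowrep i v M) + pfaffian (rowrep i w M).
Proof.
rewrite !pfaffianE -scalerAr -scalerDr; congr (_ *: _).
rewrite /pfsum mulr_sumr -big_split; apply: eq_bigr => s _ /=.
rewrite /pfterm mulrCA -mulrDr; congr (_ * _).
have [j ij] : exists j, (s (epos j) == i) || (s (opos j) == i).
  have [[j E]|[j E]] := posP ((s^-1)%g i); exists j.
    by rewrite -E permKV eqxx.
  by rewrite -E permKV eqxx orbT.
rewrite (bigD1 j) // [in X in _ = c * X + _](bigD1 j) //.
rewrite [in X in _ = _ + X](bigD1 j) //= mulrA.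
have out v' : \prod_(k < n | k != j)
      rowrep i v' M (s (epos k)) (s (opos k)) =
    \prod_(k < n | k != j) M (s (epos k)) (s (opos k)).
  apply: eq_bigr => k kj; rewrite mxE.
  have ne (f g : 'I_n -> 'I_(n.*2)) : (f k == g j) = false ->
      s (g j) = i -> (s (f k) == i) = false.
    by move=> fg <-; rewrite (inj_eq perm_inj).
  case/orP: ij => /eqP ij.
    rewrite (ne (@epos n) (@epos n)) ?(ne (@opos n) (@epos n)) ?opos_epos //.
    by rewrite (inj_eq (@epos_inj n)) (negPf kj).
  rewrite (ne (@epos n) (@opos n)) ?(ne (@opos n) (@opos n)) ?epos_opos //.
  by rewrite (inj_eq (@opos_inj n)) (negPf kj).
rewrite !out -mulrDl; congr (_ * _); rewrite !mxE.
case/orP: ij => ->; first by case: ifP => _; rewrite ?mulr0 ?addr0.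
by case: ifP => _; rewrite ?mulr0 ?addr0 // mulrN opprD.
Qed.

Lemma rowrep_id N (M : 'M[R]_N) i : skew M -> rowrep i (M i) M = M.
Proof.
move=> [sk di]; apply/matrixP => x y; rewrite mxE.
case: eqP => [->|_]; first by case: eqP => [->|//]; rewrite di.
by case: eqP => [->|//]; rewrite -sk.
Qed.

Lemma skew_rowrep N (M : 'M[R]_N) i v : skew M -> skew (rowrep i v M).
Proof.
move=> [sk di]; split=> x => [y|]; rewrite !mxE; last by case: eqP.
by case: eqP => [_|_]; case: eqP; rewrite ?oppr0 ?opprK.
Qed.

(** Exchanging the two equal rows preserves the matrix and changes the sign of
    its Pfaffian. *)
Lemma pfaffian_alternate n (M : 'M[R]_(n.*2)) i j : skew M -> j != i ->
  pfaffian (rowrep i (M j) M) = 0.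
Proof.
move=> [sk di] ji; set N := rowrep i (M j) M.
have N_sw : \matrix_(x, y) N (tperm i j x) (tperm i j y) = N.
  have rowE y : N i y = N j y.
    rewrite !mxE eqxx (negPf ji); case: (y =P i) => [_|//].
    by rewrite di oppr0.
  have colE x : N x i = N x j.
    have [skN _] := skew_rowrep i (M j) (conj sk di).
    by rewrite (skN i) (skN j) -/N rowE.
  apply/matrixP => x y; rewrite mxE.
  have -> : N (tperm i j x) (tperm i j y) = N x (tperm i j y).
    by case: tpermP => [->|->|].
  by case: tpermP => [->|->|].
have := pfaffian_perm N (tperm i j).
by rewrite N_sw odd_tperm eq_sym ji expr1 mulN1r => /algQ_eq0.
Qed.

Lemma pfaffian_addrow n (M : 'M[R]_(n.*2)) i j (c : R) : skew M -> j != i ->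
  pfaffian (rowrep i (fun y => c * M j y + M i y) M) = pfaffian M.
Proof.
move=> sk ji; rewrite pfaffian_rowrep_linear pfaffian_alternate //.
by rewrite mulr0 add0r rowrep_id.
Qed.

Definition wedge N (a b : 'I_N -> R) : 'M[R]_N :=
  \matrix_(x, y) (a x * b y - b x * a y).

Lemma skew_wedge N (M : 'M[R]_N) a b : skew M -> skew (M + wedge a b).
Proof.
move=> [sk di]; split=> [x y|x]; rewrite !mxE ?di; last by ring.
by rewrite sk; ring.
Qed.

Lemma wedge_delta N (M : 'M[R]_N) (a b : 'I_N -> R) (c : R) j : skew M ->
  M + wedge (fun x => c * (x == j)%:R + a x) b =
  rowrep j (fun y => c * b y + (M + wedge a b) j y) (M + wedge a b).
Proof.
move=> [sk di]; apply/matrixP => x y; rewrite !mxE.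
case: (x =P j) => [->|_]; case: (y =P j) => [->|_].
- by rewrite di; ring.
- by rewrite mulr1n mulr0n; ring.
- by rewrite (sk j x) mulr1n mulr0n; ring.
- by rewrite mulr0n; ring.
Qed.

(** Row i of the wedge being b, the multiples of b in the other rows can be
    removed by row operations. *)
Lemma pfaffian_rowrep_wedge n (M : 'M[R]_(n.*2)) (r : seq 'I_(n.*2))
    (c b : 'I_(n.*2) -> R) i : skew M ->
  pfaffian (rowrep i b
    (M + wedge (fun x => \sum_(j <- r) c j * (x == j)%:R) b)) =
  pfaffian (rowrep i b M).
Proof.
move=> sk; elim: r => [|j r IHr].
  congr pfaffian; apply/matrixP => x y; rewrite !mxE !big_nil mul0r mulr0.
  by rewrite subr0 addr0.
rewrite -{}IHr; set a := fun x => \sum_(k <- r) c k * (x == k)%:R.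
set a' := fun x => \sum_(k <- j :: r) _.
have -> : a' = fun x => c j * (x == j)%:R + a x.
  by apply/funext => x; rewrite /a' big_cons.
rewrite wedge_delta //; set N := M + wedge a b.
have skN : skew N by apply: skew_wedge.
case: (eqVneq j i) => [->|ji].
  congr pfaffian; apply/matrixP => x y; rewrite !mxE.
  by case: eqP => // _; case: eqP.
rewrite -[RHS](pfaffian_addrow (i := j) (j := i) (c j)); last 1 first.
- by rewrite eq_sym.
- congr pfaffian; apply/matrixP => x y; rewrite !mxE (negPf ji) eqxx.
  case: (x =P j) => [->|_]; case: (y =P j) => [->|_];
    rewrite ?(negPf ji) // ?eqxx.
    by case: eqP => // _; rewrite mulr0 add0r.
  by case: eqP => // _; rewrite mulr0 add0r opprK.
- exact: skew_rowrep.
Qed.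

(** A rank-two skew matrix has zero exterior square, so the Pfaffian is affine
    in a. The proof adds the coordinates of a one at a time. *)
Lemma pfaffian_wedge n (M : 'M[R]_(n.*2)) (a b : 'I_(n.*2) -> R) : skew M ->
  pfaffian (M + wedge a b) =
  pfaffian M + \sum_i a i * pfaffian (rowrep i b M).
Proof.
move=> sk; have aE : a = fun x => \sum_j a j * (x == j)%:R.
  apply/funext => x; rewrite (bigD1 x) //= eqxx mulr1 big1 ?addr0 // => j.
  by rewrite eq_sym => /negPf ->; rewrite mulr0.
rewrite [in LHS]aE; elim: (index_enum _) => [|j r IHr].
  rewrite big_nil addr0; congr pfaffian; apply/matrixP => x y.
  by rewrite !mxE !big_nil mul0r mulr0 subr0 addr0.
rewrite big_cons; set f := fun x => \sum_(k <- r) a k * (x == k)%:R.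
set f' := fun x => \sum_(k <- j :: r) _.
have -> : f' = fun x => a j * (x == j)%:R + f x.
  by apply/funext => x; rewrite /f' big_cons.
rewrite wedge_delta // pfaffian_rowrep_linear pfaffian_rowrep_wedge //.
rewrite rowrep_id; last exact: skew_wedge.
by rewrite IHr addrCA.
Qed.

Lemma pfaffian_rowrepN n (M : 'M[R]_(n.*2)) i v :
  pfaffian (rowrep i (fun y => - v y) M) = - pfaffian (rowrep i v M).
Proof.
have -> : (fun y => - v y) = fun y => - 2%:R * v y + v y.
  by apply/funext => y; ring.
by rewrite pfaffian_rowrep_linear; ring.
Qed.

Lemma swap_pos n (j k l : 'I_n)
    (s := (tperm (epos j) (epos k) * tperm (opos j) (opos k))%g) :
  s (epos l) = epos (tperm j k l) /\ s (opos l) = opos (tperm j k l).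
Proof.
rewrite /s !permM; split.
  by rewrite -(inj_tperm _ _ _ (@epos_inj n)) tpermD ?opos_epos.
by rewrite [X in _ X = _]tpermD ?epos_opos // -(inj_tperm _ _ _ (@opos_inj n)).
Qed.

Lemma pfterm_swap n (M : 'M[R]_(n.*2)) (j k : 'I_n) s :
  pfterm M (tperm (epos j) (epos k) * tperm (opos j) (opos k) * s)%g =
  pfterm M s.
Proof.
rewrite /pfterm; congr (_ * _).
  rewrite !odd_permM !odd_tperm !(inj_eq (@epos_inj n)) !(inj_eq (@opos_inj n)).
  by rewrite addbb.
rewrite [RHS](reindex_inj (@perm_inj _ (tperm j k))) /=.
apply: eq_bigr => l _; have [el ol] := swap_pos j k l.
by rewrite ![(_ * s)%g _]permM el ol.
Qed.

Lemma pfterm_flip n (M : 'M[R]_(n.*2)) (j : 'I_n) s : skew M ->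
  pfterm M (tperm (epos j) (opos j) * s)%g = pfterm M s.
Proof.
move=> [sk _]; rewrite /pfterm odd_permM odd_tperm epos_opos /=.
rewrite (bigD1 j) //= [in RHS](bigD1 j) //= !permM tpermL tpermR sk.
rewrite signrN !mulNr mulrN opprK; congr (_ * (_ * _)).
apply: eq_bigr => k kj; rewrite !permM !tpermD ?epos_opos ?opos_epos //.
- by rewrite (inj_eq (@opos_inj n)) eq_sym.
- by rewrite (inj_eq (@epos_inj n)) eq_sym.
Qed.

(** A term is unchanged when two pairs of positions are exchanged, or the two
    positions of a pair; so the last point can be assumed to be in last
    position, which accounts for the factor 2 (n + 1). *)
Lemma pfsum_last n (M : 'M[R]_(n.+1.*2)) : skew M ->
  pfsum M = (2 * n.+1)%:R *
    \sum_(s : 'S_(n.*2).+2 | s ord_max == ord_max) pfterm M s.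
Proof.
move=> sk.
have omax : opos (ord_max : 'I_n.+1) = ord_max :> 'I_(n.*2).+2.
  exact: val_inj.
rewrite /pfsum (partition_big (fun s : 'S_(n.*2).+2 => (s^-1)%g ord_max) predT) //=.
set A := \sum_(s : 'S_(n.*2).+2 | s ord_max == ord_max) _.
have AE (p : 'I_(n.*2).+2) :
    \sum_(s : 'S_(n.*2).+2 | (s^-1)%g ord_max == p) pfterm M s = A.
  have permVE (s : 'S_(n.*2).+2) (x : 'I_(n.*2).+2) : ((s^-1)%g ord_max == x) = (s x == ord_max).
    by rewrite -(inj_eq (@perm_inj _ s)) permKV eq_sym.
  have odd_case (j : 'I_n.+1) :
    \sum_(s : 'S_(n.*2).+2 | s (opos j) == ord_max) pfterm M s = A.
    rewrite (reindex_inj (mulgI (tperm (epos j) (epos ord_max) *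
      tperm (opos j) (opos ord_max))%g)) /A.
    apply: eq_big => [s|s _]; last exact: pfterm_swap.
    rewrite permM.
    have [_ ->] := swap_pos j ord_max j.
    by rewrite tpermL omax.
  under eq_bigl do rewrite permVE.
  have [[j ->]|[j ->]] := @posP n.+1 p; last exact: odd_case.
  rewrite (reindex_inj (mulgI (tperm (epos j) (opos j)))) -[RHS](odd_case j).
  apply: eq_big => [s|s _]; last exact: pfterm_flip.
  by rewrite permM tpermL.
under eq_bigr do rewrite AE.
rewrite sumr_const card_ord mulr_natl; congr (_ *+ _).
by rewrite mul2n.
Qed.

(** Only the permutations that pair the last two points contribute. *)
Lemma pfaffian_last n (M : 'M[R]_(n.+1.*2)) (M' : 'M[R]_(n.*2)) : skew M ->
    (forall x y : 'I_(n.*2), M (lift ord_max (lift ord_max x) : 'I_(n.*2).+2)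
       (lift ord_max (lift ord_max y) : 'I_(n.*2).+2) = M' x y) ->
    (forall x : 'I_(n.*2).+2, x != epos (ord_max : 'I_n.+1) :> 'I_(n.*2).+2 ->
       M x (ord_max : 'I_(n.*2).+2) = 0) ->
    M (epos ord_max) (opos ord_max) = 1 ->
  pfaffian M = pfaffian M'.
Proof.
move=> sk MM' M0 M1; rewrite !pfaffianE pfsum_last // mulr_natl -scaler_nat.
rewrite scalerA expnS factS.
have -> : (2 * 2 ^ n * (n.+1 * n`!) = 2 * n.+1 * (2 ^ n * n`!))%N by ring.
rewrite natrM invfM mulrAC mulVf ?mul1r; last first.
  by rewrite Num.Theory.pnatr_eq0.
congr (_ *: _).
have omax : opos (ord_max : 'I_n.+1) = ord_max :> 'I_(n.*2).+2.
  exact: val_inj.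
have emax : epos (ord_max : 'I_n.+1) = lift ord_max ord_max :> 'I_(n.*2).+2.
  by apply: val_inj; rewrite /= /bump leqNgt ltnSn.
rewrite sum_perm_fix (bigID (fun s : 'S_(n.*2).+1 => s ord_max == ord_max)) /=.
rewrite [X in _ + X]big1 ?addr0; last first.
  move=> s sm; rewrite /pfterm big_ord_recr /= omax emax lift_perm_id.
  rewrite lift_perm_lift M0 ?mulr0 // emax.
  by rewrite (inj_eq lift_inj).
rewrite sum_perm_fix; apply: eq_bigr => s _; rewrite /pfterm.
rewrite !odd_lift_perm /= !addbb; congr (_ * _).
have ewid (i : 'I_n) : epos (widen_ord (leqnSn n) i) =
    lift ord_max (lift ord_max (epos i)) :> 'I_(n.*2).+2.
  by apply: val_inj; rewrite /= /bump; have := ltn_ord i; lia.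
have owid (i : 'I_n) : opos (widen_ord (leqnSn n) i) =
    lift ord_max (lift ord_max (opos i)) :> 'I_(n.*2).+2.
  by apply: val_inj; rewrite /= /bump; have := ltn_ord i; lia.
rewrite big_ord_recr /= omax emax lift_perm_id lift_perm_lift lift_perm_id.
rewrite -emax -omax M1 mulr1; apply: eq_bigr => i _.
by rewrite ewid owid !lift_perm_lift MM'.
Qed.

(** Subtracting the last row but one from the last leaves one nonzero entry. *)
Lemma pfaffian_last_repeat n (M : 'M[R]_(n.+1.*2)) (M' : 'M[R]_(n.*2)) :
    skew M ->
    (forall x y : 'I_(n.*2), M (lift ord_max (lift ord_max x) : 'I_(n.*2).+2)
       (lift ord_max (lift ord_max y) : 'I_(n.*2).+2) = M' x y) ->
    (forall x : 'I_(n.*2), M (lift ord_max (lift ord_max x) : 'I_(n.*2).+2)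
      (opos ord_max) =
      M (lift ord_max (lift ord_max x) : 'I_(n.*2).+2) (epos ord_max)) ->
    M (epos ord_max) (opos ord_max) = 1 ->
  pfaffian M = pfaffian M'.
Proof.
move=> sk MM' Mrep M1; have [skM diM] := sk.
pose e : 'I_(n.+1.*2) := epos ord_max; pose o : 'I_(n.+1.*2) := opos ord_max.
have eo : (e == o) = false by rewrite epos_opos.
rewrite -(pfaffian_addrow (i := o) (j := e) (-1) sk) ?eo //.
have cases (x : 'I_(n.*2).+2) : [\/ x = o, x = e |
    exists x' : 'I_(n.*2), x = lift ord_max (lift ord_max x')].
  case: (unliftP ord_max x) => [y ->|->]; last by apply: Or31; apply: val_inj.
  case: (unliftP ord_max y) => [z ->|->]; first by apply: Or33; exists z.
  by apply: Or32; apply: val_inj; rewrite /= /bump leqNgt ltnSn.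
have neq (x : 'I_(n.*2)) : ((lift ord_max (lift ord_max x) : 'I_(n.*2).+2) == o) = false.
  apply/eqP => /(congr1 val); rewrite /= /bump; have := ltn_ord x; lia.
apply: pfaffian_last.
- exact: skew_rowrep.
- by move=> x y; rewrite mxE !neq.
- move=> x xe; rewrite mxE.
  have -> : (ord_max : 'I_(n.*2).+2) = o by apply: val_inj.
  rewrite eqxx; case: (cases x) => [->|xE|[x' ->]].
  + by rewrite eqxx.
  + by rewrite xE eqxx in xe.
  + by rewrite neq (skM _ o) (skM _ e) Mrep; ring.
- rewrite mxE -/e -/o eo eqxx diM mulr0 add0r -skM.
  exact: M1.
Qed.

End Pfaffian.

(** * The action of D_k on the functions Q *)

Lemma nth_Posz (l : seq nat) i : (map Posz l)`_i = Posz (nth 0%N l i).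
Proof. by elim: l i => [|x l IHl] [|i] //=. Qed.

Lemma QmxE (l : seq nat) N (x y : 'I_N) : Qmx (map Posz l) N x y =
  if (x < y)%N then Q2 (nth 0%N l x) (nth 0%N l y)
  else if (y < x)%N then - Q2 (nth 0%N l y) (nth 0%N l x) else 0.
Proof. by rewrite mxE !nth_Posz. Qed.

Lemma skew_Qmx l N : skew (Qmx l N).
Proof.
split=> x => [y|]; rewrite !mxE; last by rewrite ltnn.
by case: ltngtP => _; rewrite ?opprK ?oppr0.
Qed.

Lemma eq_Qmx (l l' : seq nat) N : (forall i, nth 0%N l i = nth 0%N l' i) ->
  Qmx (map Posz l) N = Qmx (map Posz l') N.
Proof. by move=> ll'; apply/matrixP => x y; rewrite !QmxE !ll'. Qed.

(** As Q_(r, 0) = q_r, the rows of the two added zeros agree, except for their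
    common entry Q_(0, 0) = 1. The zeros are the default values of nth. *)
Lemma pfaffian_Qmx_step (l : seq nat) n : (size l <= n.*2)%N ->
  pfaffian (Qmx (map Posz l) n.+1.*2) = pfaffian (Qmx (map Posz l) n.*2).
Proof.
move=> ln; have l0 i : (n.*2 <= i)%N -> nth 0%N l i = 0%N.
  by move=> ni; rewrite nth_default // (leq_trans ln).
have vx (x : 'I_(n.*2)) : (lift ord_max (lift ord_max x) : 'I_(n.*2).+2) = x :> nat.
  by rewrite /= /bump; have := ltn_ord x; lia.
apply: pfaffian_last_repeat; first exact: skew_Qmx.
- by move=> x y; rewrite !QmxE !vx.
- move=> x; rewrite !QmxE !vx /= (l0 n.*2) // (l0 n.*2.+1) //.
  by have xn := ltn_ord x; rewrite xn (ltnW (xn : (x < n.*2)%N) : (x < n.*2.+1)%N).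
- by rewrite QmxE /= ltnSn !l0 // Q2_0 q0.
Qed.

Lemma pfaffian_Qmx (l : seq nat) n : (size l <= n.*2)%N ->
  pfaffian (Qmx (map Posz l) n.*2) = QP l.
Proof.
move=> ln; rewrite /QP /Q size_map.
set l' := if odd _ then _ else _.
have -> : l' = map Posz (if odd (size l) then rcons l 0%N else l).
  by rewrite /l'; case: odd; rewrite // map_rcons.
rewrite size_map; set l'' := if odd _ then _ else _.
have sl : ((size l'')./2.*2 = size l + odd (size l))%N.
  by rewrite /l''; case E: odd; rewrite ?size_rcons; lia.
rewrite (@eq_Qmx l'' l); last first.
  move=> i; rewrite /l''; case: odd => //; rewrite nth_rcons.
  by case: ltngtP => // li; rewrite nth_default // ?li // ltnW.
set n0 := (size l'')./2 in sl *.
have [k ->] : exists k, n = (n0 + k)%N by exists (n - n0)%N; lia.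
elim: k => [|k IHk]; first by rewrite addn0.
by rewrite addnS pfaffian_Qmx_step ?IHk //; lia.
Qed.

Lemma QP_nil : QP [::] = 1.
Proof.
rewrite -(@pfaffian_Qmx [::] 0) // pfaffianE mul1n fact0 invr1 scale1r /pfsum.
rewrite (eq_bigr (fun=> 1)) => [|s _].
  by rewrite sumr_const card_Sn.
rewrite /pfterm big_ord0 mulr1.
have -> : s = 1%g by apply/permP => -[].
by rewrite odd_perm1.
Qed.

Lemma shift_pfaffian n (M : 'M[series nat]_(n.*2)) :
  shift (pfaffian M) = pfaffian (map_mx shift M).
Proof.
rewrite !pfaffianE embedZ; congr (_ *: _); rewrite /pfsum embed_sum.
apply: eq_bigr => s _; rewrite /pfterm embedM embed_prod; congr (_ * _).
  by rewrite -signr_odd; case: odd; rewrite ?embedN embed1.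
by apply: eq_bigr => i _; rewrite mxE.
Qed.

Definition qvec (l : seq nat) N (x : 'I_N) : series nat := q (nth 0%N l x).

Lemma Qmx_shift (l : seq nat) N : Qmx (map Posz l) N =
  map_mx shift (Qmx (map Posz l) N) +
  wedge (@qvec l N) (fun x => shift (qvec l x)).
Proof.
apply/matrixP => x y; rewrite !mxE !nth_Posz /qvec.
case: (ltngtP x y) => [_|_|/val_inj ->].
- by rewrite {1}Q2_shift addrA.
- rewrite {1}Q2_shift embedN.
  by move: (q _) (q _) (shift _) (shift _) (shift _) => a b c d e; ring.
- by rewrite embed0 add0r mulrC subrr.
Qed.

(** Adjoining u perturbs the matrix by a wedge. *)
Lemma Q_branch (l : seq nat) n : pfaffian (Qmx (map Posz l) n.*2) =
  shift (pfaffian (Qmx (map Posz l) n.*2)) +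
  \sum_i qvec l i * shift (pfaffian (rowrep i (@qvec l n.*2) (Qmx (map Posz l) n.*2))).
Proof.
have sk : skew (map_mx shift (Qmx (map Posz l) n.*2)).
  have [sk di] := skew_Qmx (map Posz l) n.*2.
  by split=> x => [y|]; rewrite !mxE ?ltnn ?embed0 //; case: ltngtP => _; rewrite ?embedN ?opprK ?embed0 ?oppr0.
rewrite {1}Qmx_shift pfaffian_wedge // -shift_pfaffian; congr (_ + _).
apply: eq_bigr => i _; rewrite shift_pfaffian; congr (_ * pfaffian _).
apply/matrixP => x y; rewrite !(mxE, nth_Posz).
by case: eqP => _; case: eqP => _; rewrite ?embed0 ?embedN.
Qed.

(** Only the factors qvec l i of Q_branch involve u. *)
Lemma Dk_pfaffian k (l : seq nat) n : (0 < k)%N ->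
  Dk k (pfaffian (Qmx (map Posz l) n.*2)) =
  \sum_(i < n.*2) (2 * (nth 0%N l i == k))%:R *
    pfaffian (rowrep i (@qvec l n.*2) (Qmx (map Posz l) n.*2)).
Proof.
move=> k0; rewrite {1}Q_branch Dk_add Dk_sum.
rewrite -[shift _]mul1r Dk_shiftM Dk_1 // mul0r add0r.
by apply: eq_bigr => i _; rewrite Dk_shiftM Dk_q.
Qed.

Lemma nth_rem (l : seq nat) k i :
  nth 0%N (rem k l) i = nth 0%N l (bump (index k l) i).
Proof.
elim: l i => [|x l IHl] i /=; first by rewrite !nth_nil.
case: (x =P k) => _ //.
by case: i => [|i] //=; rewrite IHl bumpS.
Qed.

Lemma strict_index (l : seq nat) k i : (0 < k)%N ->
  uniq [seq x <- l | x != 0%N] -> nth 0%N l i = k -> i = index k l.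
Proof.
move=> k0; elim: l i => [|x l IHl] [|i] //=; try by move=> _ ?; lia.
  by move=> _ ->; rewrite eqxx.
move=> u ik; have kl : k \in l.
  rewrite -ik mem_nth // ltnNge; apply/negP => li.
  by rewrite nth_default // in ik; lia.
case: (x =P k) u => [->|_].
  by rewrite -lt0n k0 /= mem_filter kl -lt0n k0.
by case: ifP => _ => [/andP[_]|] u; rewrite (IHl i).
Qed.

(** Replacing row i by the q_(l_j) = Q_(l_j, 0) amounts, up to sign, to
    removing l_i and appending 0. *)
Lemma pfaffian_rowrep_rem (l : seq nat) n k (i : 'I_(n.+1.*2)) :
    (size l <= n.+1.*2)%N -> k \in l -> i = index k l :> nat ->
  pfaffian (rowrep i (@qvec l n.+1.*2) (Qmx (map Posz l) n.+1.*2)) =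
  (-1) ^+ index k l * QP (rem k l).
Proof.
move=> ln kl ik; set v := @qvec l _; set M := Qmx _ _.
have sr : ((size (rem k l)).+1 = size l)%N.
  by rewrite size_rem // prednK //; case: (l) kl.
rewrite -(@pfaffian_Qmx _ n.+1); last by rewrite (leq_trans _ ln) // -sr.
pose t : 'S_(n.*2).+2 := lift_perm ord_max i 1.
have -> : Qmx (map Posz (rem k l)) n.+1.*2 =
    \matrix_(x, y) rowrep i (fun y => - v y) M (t x) (t y).
  have vm (x : 'I_(n.*2).+1) : (lift ord_max x : 'I_(n.*2).+2) = x :> nat.
    by rewrite /= /bump; have := ltn_ord x; lia.
  have nb (x : 'I_(n.*2).+1) : (lift i x == i) = false.
    by rewrite eq_sym (negPf (neq_lift i x)).
  have lmax : nth 0%N (rem k l) n.*2.+1 = 0%N.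
    by rewrite nth_default // -ltnS sr.
  apply/matrixP => x y; rewrite QmxE [RHS]mxE mxE /t.
  case: (unliftP (ord_max : 'I_(n.*2).+2) x) => [x' ->|->];
  case: (unliftP (ord_max : 'I_(n.*2).+2) y) => [y' ->|->];
  rewrite ?lift_perm_lift ?lift_perm_id ?perm1 ?nb ?eqxx ?vm.
  - rewrite QmxE !nth_rem -ik /= !ltnNge !leq_bump2.
    by [].
  - by rewrite /= ltn_ord lmax Q2_0 opprK /v /qvec nth_rem -ik.
  - have yn := ltn_ord y'; rewrite ltnNge (ltnW yn) /= yn lmax Q2_0.
    by rewrite /v /qvec nth_rem -ik.
  - by rewrite ltnn.
rewrite pfaffian_perm pfaffian_rowrepN odd_lift_perm odd_perm1 addbF /=.
rewrite odd_double /= -signr_odd ik signrN mulrNN signr_odd mulrA -expr2.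
by rewrite sqrr_sign mul1r.
Qed.

Lemma Dk_QP k (l : seq nat) : (0 < k)%N -> strict_partition l ->
  Dk k (QP l) = if k \in l then
    (-1) ^+ ((index k l).+1 + 1) * 2%:R * QP (rem k l) else 0.
Proof.
move=> k0 /andP[_ ul].
pose n := (size l).
have ln : (size l <= n.+1.*2)%N by rewrite /n; lia.
rewrite -(pfaffian_Qmx ln) Dk_pfaffian //; case: ifP => [kl|nkl]; last first.
  rewrite big1 // => i _; case: eqP => [E|]; last by rewrite muln0 mul0r.
  move: nkl; rewrite -E mem_nth // ltnNge; apply/negP => li.
  by rewrite nth_default // in E; lia.
have il : (index k l < n.+1.*2)%N by rewrite (leq_trans _ ln) // index_mem.
rewrite (bigD1 (Ordinal il)) //= big1 ?addr0 => [|i].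
  rewrite nth_index // eqxx muln1 (pfaffian_rowrep_rem ln kl) //.
  by rewrite addn1 !exprS !mulN1r opprK mulrA [_ %:R * _]mulrC.
move=> ni; case: eqP => [E|]; last by rewrite muln0 mul0r.
by rewrite -(inj_eq val_inj) /= -(strict_index k0 ul E) eqxx in ni.
Qed.

Lemma is_Dop_Dk k : (0 < k)%N -> is_Dop k (Dk k).
Proof.
move=> k0; split=> [c f g _ _|l sl]; first exact: Dk_linear.
exact: Dk_QP.
Qed.

(** * The functions Q span Gamma *)

Definition qprod (nu : seq nat) : series nat := \prod_(x <- nu) q (Posz x).

Inductive qspan (P : seq nat -> Prop) : series nat -> Prop :=
| qspan0 : qspan P 0
| qspan_add (c : rat) nu f of P nu & qspan P f : qspan P (c *: qprod nu + f).

Lemma qspanD P f g : qspan P f -> qspan P g -> qspan P (f + g).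
Proof.
elim=> [|c nu h Pnu _ IHh] Pg; first by rewrite add0r.
by rewrite -addrA; apply: qspan_add => //; apply: IHh.
Qed.

Lemma qspanZ P (c : rat) f : qspan P f -> qspan P (c *: f).
Proof.
elim=> [|d nu h Pnu _ IHh]; first by rewrite scaler0; apply: qspan0.
by rewrite scalerDr scalerA; apply: qspan_add.
Qed.

Lemma qspanN P f : qspan P f -> qspan P (- f).
Proof. by rewrite -scaleN1r; apply: qspanZ. Qed.

Lemma qspan_qprod (P : seq nat -> Prop) nu : P nu -> qspan P (qprod nu).
Proof.
move=> Pnu; rewrite -[qprod nu]scale1r -[X in qspan P X]addr0.
by apply: qspan_add => //; apply: qspan0.
Qed.

Lemma qspan_sum P (T : Type) (r : seq T) (p : pred T) (F : T -> series nat) :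
  (forall t, p t -> qspan P (F t)) -> qspan P (\sum_(t <- r | p t) F t).
Proof. by move=> PF; apply: big_ind => //; [apply: qspan0|apply: qspanD]. Qed.

Lemma qprod_cat nu nu' : qprod (nu ++ nu') = qprod nu * qprod nu'.
Proof. exact: big_cat. Qed.

Lemma qspanM (P P' P'' : seq nat -> Prop) f g :
    (forall nu nu', P nu -> P' nu' -> P'' (nu ++ nu')) ->
  qspan P f -> qspan P' g -> qspan P'' (f * g).
Proof.
move=> PP; elim=> [|c nu h Pnu _ IHh] Pg; first by rewrite mul0r; apply: qspan0.
rewrite mulrDl; apply: qspanD; last exact: IHh.
rewrite -scalerAl; apply: qspanZ; elim: Pg => [|d nu' h' P'nu _ IHh'].
  by rewrite mulr0; apply: qspan0.
rewrite mulrDr -scalerAr -qprod_cat; apply: qspan_add => //.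
exact: PP.
Qed.

Lemma qspan_sub (P P' : seq nat -> Prop) f :
  (forall nu, P nu -> P' nu) -> qspan P f -> qspan P' f.
Proof.
move=> PP; elim=> [|c nu h Pnu _ IHh]; first exact: qspan0.
by apply: qspan_add => //; apply: PP.
Qed.

Lemma Gamma_qspan f : Gamma f -> qspan (fun=> True) f.
Proof.
elim=> [n _|c|g h _ IHg _ IHh|g h _ IHg _ IHh].
- have -> : q n = qprod [:: n] by rewrite /qprod big_seq1.
  exact: qspan_qprod.
- have -> : c%:A = c *: qprod [::] by rewrite /qprod big_nil.
  by apply/qspanZ/qspan_qprod.
- exact: qspanD.
- exact: qspanM IHg IHh.
Qed.

(** The filtration of the homogeneous component of degree d by the sum of the
    squares of the parts: raising operators (r, s) |-> (r + i, s - i) with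
    r >= s strictly increase this sum, which is at most d ^ 2. *)
Definition sqs (nu : seq nat) : nat := \sum_(x <- nu) x ^ 2.

Definition wt (d N : nat) (nu : seq nat) : Prop :=
  (\sum_(x <- nu) x = d)%N /\ (N <= sqs nu)%N.

Lemma wt_cat d N d' N' nu nu' :
  wt d N nu -> wt d' N' nu' -> wt (d + d') (N + N') (nu ++ nu').
Proof. by move=> [<- Nn] [<- Nn']; rewrite /wt /sqs !big_cat leq_add. Qed.

Lemma wt_leq d N N' nu : (N' <= N)%N -> wt d N nu -> wt d N' nu.
Proof. by move=> NN [dn Nn]; split=> //; apply: leq_trans Nn. Qed.

Lemma sqs_leq nu : (sqs nu <= (\sum_(x <- nu) x) ^ 2)%N.
Proof.
rewrite /sqs; elim: nu => [|x nu IHnu]; first by rewrite !big_nil.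
rewrite !big_cons; move: (\sum_(j <- nu) j)%N (\sum_(j <- nu) j ^ 2)%N IHnu.
by move=> a b; rewrite -!mulnn; nia.
Qed.

(** g is a leading term of f for the filtration. *)
Definition near_eq d N (f g : series nat) :=
  qspan (wt d N) g /\ qspan (wt d N.+1) (f - g).

Lemma near_eq_refl d N g : qspan (wt d N) g -> near_eq d N g g.
Proof. by move=> Pg; split=> //; rewrite subrr; apply: qspan0. Qed.

Lemma near_eqM d N d' N' f g f' g' : near_eq d N f g -> near_eq d' N' f' g' ->
  near_eq (d + d') (N + N') (f * f') (g * g').
Proof.
move=> [Pg Pfg] [Pg' Pfg']; split; first exact: qspanM (@wt_cat _ _ _ _) Pg Pg'.
have -> : f * f' - g * g' = (f - g) * g' + ((f - g) * (f' - g') + g * (f' - g')).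
  by ring.
apply: qspanD.
  by rewrite -addSn; apply: qspanM (@wt_cat _ _ _ _) Pfg Pg'.
apply: qspanD; last by rewrite -addnS; apply: qspanM (@wt_cat _ _ _ _) Pg Pfg'.
apply: (@qspan_sub (wt (d + d') (N.+1 + N'.+1))).
  by move=> nu; apply: wt_leq; lia.
exact: qspanM (@wt_cat _ _ _ _) Pfg Pfg'.
Qed.

Lemma near_eqD d N f g f' g' : near_eq d N f g -> near_eq d N f' g' ->
  near_eq d N (f + f') (g + g').
Proof.
move=> [Pg Pfg] [Pg' Pfg']; split; first exact: qspanD.
by rewrite opprD addrACA; apply: qspanD.
Qed.

Lemma near_eqZ d N (c : rat) f g : near_eq d N f g -> near_eq d N (c *: f) (c *: g).
Proof.
move=> [Pg Pfg]; split; first exact: qspanZ.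
by rewrite -scalerBr; apply: qspanZ.
Qed.

Lemma near_eqN d N f g : near_eq d N f g -> near_eq d N (- f) (- g).
Proof. by rewrite -!scaleN1r; apply: near_eqZ. Qed.

Lemma near_eq1 : near_eq 0 0 1 1.
Proof.
apply: near_eq_refl; have -> : 1 = qprod [::] by rewrite /qprod big_nil.
by apply: qspan_qprod; split; rewrite /sqs ?big_nil.
Qed.

Lemma near_eq0 d N : near_eq d N 0 0.
Proof. exact/near_eq_refl/qspan0. Qed.

Lemma near_eq_sum d N (T : Type) (r : seq T) (F G : T -> series nat) :
    (forall t, near_eq d N (F t) (G t)) ->
  near_eq d N (\sum_(t <- r) F t) (\sum_(t <- r) G t).
Proof.
move=> FG; elim: r => [|t r IHr]; first by rewrite !big_nil; apply: near_eq0.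
by rewrite !big_cons; apply: near_eqD.
Qed.

Lemma near_eq_prod (T : Type) (r : seq T) (d N : T -> nat)
    (F G : T -> series nat) : (forall t, near_eq (d t) (N t) (F t) (G t)) ->
  near_eq (\sum_(t <- r) d t) (\sum_(t <- r) N t)
    (\prod_(t <- r) F t) (\prod_(t <- r) G t).
Proof.
move=> FG; elim: r => [|t r IHr]; first by rewrite !big_nil; apply: near_eq1.
by rewrite !big_cons; apply: near_eqM.
Qed.

Lemma sign_scale n (f : series nat) : (-1) ^+ n * f = ((-1) ^+ n : rat) *: f.
Proof.
rewrite -signr_odd -[in RHS]signr_odd.
by case: odd; rewrite /= ?expr1 ?expr0 ?mulN1r ?mul1r ?scaleN1r ?scale1r.
Qed.

Lemma near_eq_Q2 (r s : nat) : (s <= r)%N ->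
  near_eq (r + s) (r ^ 2 + s ^ 2) (Q2 r s) (q r * q s).
Proof.
have qq (a b : nat) : q a * q b = qprod [:: a; b].
  by rewrite /qprod big_cons big_seq1.
move=> sr; split.
  by rewrite qq; apply: qspan_qprod; rewrite /wt /sqs !big_cons !big_nil !addn0.
rewrite Q2E addrC addKr -scaler_nat; apply/qspanZ/qspan_sum => i _.
rewrite sign_scale; apply: qspanZ; rewrite qq; apply: qspan_qprod.
have := ltn_ord i; rewrite /wt /sqs !big_cons !big_nil -!mulnn !addn0 => si.
by split; [lia | nia].
Qed.

Lemma big_pos (V : Type) (idx : V) (op : Monoid.com_law idx) n
    (F : 'I_(n.*2) -> V) :
  \big[op/idx]_x F x = \big[op/idx]_(i < n) op (F (epos i)) (F (opos i)).
Proof.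
elim: n F => [|n IHn] F; first by rewrite !big_ord0.
rewrite [LHS](@big_ord_recr _ _ _ (n.*2).+1 F) (@big_ord_recr _ _ _ (n.*2)
  (fun x => F (widen_ord (leqnSn (n.*2).+1) x))) /=.
rewrite [RHS]big_ord_recr /=.
rewrite (IHn (fun x => F (widen_ord (leqnSn (n.*2).+1) (widen_ord (leqnSn n.*2) x)))).
rewrite -Monoid.mulmA; congr (op _ (op _ _)).
- by apply: eq_bigr => i _; congr (op (F _) (F _)); apply: val_inj.
- by congr F; apply: val_inj.
- by congr F; apply: val_inj.
Qed.

Lemma big_nth_pad (V : Type) (idx : V) (op : Monoid.com_law idx) (l : seq nat)
    N (F : nat -> V) : F 0%N = idx -> (size l <= N)%N ->
  \big[op/idx]_(x < N) F (nth 0%N l x) = \big[op/idx]_(x <- l) F x.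
Proof.
move=> F0 lN; rewrite (big_nth 0%N) big_mkord.
rewrite [RHS](big_ord_widen N (fun i => F (nth 0%N l i))) // [RHS]big_mkcond.
apply: eq_bigr => x _; case: ltnP => // lx.
by rewrite nth_default.
Qed.

(** The leading term of Q_l is q_l: every perfect matching contributes q_l,
    and the signs add up to the Pfaffian Q_() of the matrix with entries 1. *)
Lemma near_eq_QP (l : seq nat) : sorted geq l ->
  near_eq (\sum_(x <- l) x) (sqs l) (QP l) (qprod l).
Proof.
move=> sl; pose n := size l; have ln : (size l <= n.*2)%N by rewrite /n; lia.
have lmono i j : (i <= j)%N -> (nth 0%N l j <= nth 0%N l i)%N.
  move=> ij; have [jl|lj] := ltnP j (size l); last by rewrite (nth_default _ lj).
  have geq_trans : transitive geq by move=> a b c ab bc; apply: leq_trans bc ab.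
  exact: (sorted_leq_nth geq_trans leqnn 0%N sl _ _ (leq_ltn_trans ij jl) jl ij).
have -> : qprod l = QP [::] * qprod l by rewrite QP_nil mul1r.
rewrite -(pfaffian_Qmx ln) -(@pfaffian_Qmx [::] n) // !pfaffianE -scalerAl.
apply: near_eqZ; rewrite /pfsum mulr_suml; apply: near_eq_sum => s.
pose L (x : 'I_(n.*2)) := nth 0%N l x.
have reidx (V : Type) (idx : V) (op : Monoid.com_law idx) (F : nat -> V) :
    F 0%N = idx ->
    \big[op/idx]_(x <- l) F x =
    \big[op/idx]_(i < n) op (F (L (s (epos i)))) (F (L (s (opos i)))).
  move=> F0; rewrite -(big_nth_pad op F0 ln) (reindex_inj (@perm_inj _ s)).
  exact: big_pos.
rewrite /pfterm -mulrA !sign_scale.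
apply: near_eqZ; rewrite /qprod /sqs (reidx _ _ _ (fun x => q (Posz x))) ?q0 //.
rewrite (reidx _ _ _ (fun x => x)) // (reidx _ _ _ (fun x => x ^ 2)%N) //.
rewrite -big_split; apply: near_eq_prod => i.
rewrite (QmxE l) (QmxE [::]) !nth_nil Q2_0 q0 -/(L _) -/(L _).
case: ltngtP => [xy|yx|_] /=.
- by rewrite mul1r; apply/near_eq_Q2/lmono/ltnW.
- rewrite mulN1r; apply: near_eqN; rewrite addnC [(_ ^ 2 + _)%N]addnC mulrC.
  exact/near_eq_Q2/lmono/ltnW.
- by rewrite mul0r; apply: near_eq0.
Qed.

Lemma perm_qprod nu nu' : perm_eq nu nu' -> qprod nu = qprod nu'.
Proof. exact: perm_big. Qed.

(** A repeated part can be raised, as Q_(r, r) = 0. *)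
Lemma qspan_repeat (r : nat) nu : (0 < r)%N ->
  qspan (wt (\sum_(x <- r :: r :: nu) x) (sqs (r :: r :: nu)).+1)
    (qprod (r :: r :: nu)).
Proof.
move=> r0; have [_ Q2r] := near_eq_Q2 (leqnn r).
rewrite Q2_diag // sub0r in Q2r; rewrite /sqs !big_cons addnA addnA -addSn.
rewrite /qprod !big_cons mulrA; apply: qspanM (@wt_cat _ _ _ _) _ _.
  by rewrite -[q r * q r]opprK; apply: qspanN.
exact: qspan_qprod.
Qed.

Lemma repeated_part (l : seq nat) : ~~ uniq [seq x <- l | x != 0%N] ->
  exists r nu, (0 < r)%N /\ perm_eq l (r :: r :: nu).
Proof.
elim: l => [|x l IHl] // nu_l.
have IH : ~~ uniq [seq x <- l | x != 0%N] ->
    exists r nu, (0 < r)%N /\ perm_eq (x :: l) (r :: r :: nu).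
  move=> /IHl[r [nu [r0 lr]]]; exists r, (x :: nu); split=> //.
  rewrite -(perm_cons x) in lr; apply: perm_trans lr _.
  exact/permPl/(perm_catCA [:: x] [:: r; r] nu).
move: nu_l => /=; case: eqP => [_|/eqP x0] //=.
case: (boolP (x \in _)) => [xl _|_] //=.
exists x, (rem x l); split; first by rewrite lt0n.
by rewrite perm_cons perm_to_rem //; move: xl; rewrite mem_filter => /andP[].
Qed.

(** By induction on the filtration, from the top down. *)
Lemma qprod_QP_ind (W : series nat -> Prop) : W 0 ->
    (forall (c : rat) f g, W f -> W g -> W (c *: f + g)) ->
    (forall l, strict_partition l -> W (QP l)) ->
  forall nu, W (qprod nu).
Proof.
move=> W0 Wlin WQ nu.
have [k] := ubnP ((\sum_(x <- nu) x) ^ 2 - sqs nu)%N.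
elim: k nu => // k IHk nu nuk.
have Wspan f : qspan (wt (\sum_(x <- nu) x) (sqs nu).+1) f -> W f.
  elim=> // c nu' g [d_nu' s_nu'] _; apply: Wlin; apply: IHk.
  by have := sqs_leq nu'; rewrite d_nu'; lia.
case: (boolP (uniq [seq x <- nu | x != 0%N])) => [u|/repeated_part].
  pose l := sort geq nu.
  have nul : perm_eq l nu by rewrite perm_sort.
  have sl : sorted geq l by apply: sort_sorted => a b; exact: leq_total.
  have stl : strict_partition l.
    by rewrite /strict_partition sl (perm_uniq (perm_filter _ nul)).
  have [_] := near_eq_QP sl; rewrite /sqs !(perm_big _ nul) -/(sqs nu).
  move=> /qspanN /Wspan; rewrite opprB => Wd; have := Wlin 1 _ _ Wd (WQ _ stl).
  by rewrite scale1r subrK (perm_qprod nul).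
move=> [r [nu' [r0 rnu]]]; apply: Wspan; rewrite (perm_qprod rnu).
by rewrite /sqs !(perm_big _ rnu); apply: qspan_repeat.
Qed.

Lemma Gamma_QP_ind (W : series nat -> Prop) : W 0 ->
    (forall (c : rat) f g, W f -> W g -> W (c *: f + g)) ->
    (forall l, strict_partition l -> W (QP l)) ->
  forall f, Gamma f -> W f.
Proof.
move=> W0 Wlin WQ f /Gamma_qspan; elim=> // c nu g _ _.
exact: Wlin (qprod_QP_ind W0 Wlin WQ nu).
Qed.

(** ** Membership in Gamma *)

Lemma GammaZ (c : rat) f : Gamma f -> Gamma (c *: f).
Proof. by rewrite -mulr_algl => Gf; apply: Gamma_mul => //; apply: Gamma_const. Qed.

Lemma Gamma0 : Gamma 0.
Proof. by rewrite -(scale0r 1); apply: Gamma_const. Qed.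

Lemma Gamma1 : Gamma 1.
Proof. by rewrite -(scale1r 1); apply: Gamma_const. Qed.

Lemma GammaN f : Gamma f -> Gamma (- f).
Proof. by rewrite -scaleN1r; apply: GammaZ. Qed.

Lemma Gamma_sum (T : Type) (r : seq T) (p : pred T) (F : T -> series nat) :
  (forall t, p t -> Gamma (F t)) -> Gamma (\sum_(t <- r | p t) F t).
Proof. by move=> GF; apply: big_ind => //; [apply: Gamma0|apply: Gamma_add]. Qed.

Lemma Gamma_prod (T : Type) (r : seq T) (p : pred T) (F : T -> series nat) :
  (forall t, p t -> Gamma (F t)) -> Gamma (\prod_(t <- r | p t) F t).
Proof. by move=> GF; apply: big_ind => //; [apply: Gamma1|apply: Gamma_mul]. Qed.

Lemma Gamma_qn (n : nat) : Gamma (q n).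
Proof. by case: n => [|n]; [rewrite q0; apply: Gamma1 | apply: Gamma_q]. Qed.

Lemma Gamma_Q2 (r s : nat) : Gamma (Q2 r s).
Proof.
elim: s r => [|s IHs] r; first by rewrite Q2_0; apply: Gamma_qn.
rewrite Q2_rec; apply: Gamma_add; last exact/GammaN/IHs.
by apply: Gamma_add; [|apply: GammaN]; apply: Gamma_mul; apply: Gamma_qn.
Qed.

Lemma Gamma_QP l : Gamma (QP l).
Proof.
have ln : (size l <= (size l).*2)%N by lia.
rewrite -(pfaffian_Qmx ln) pfaffianE; apply/GammaZ/Gamma_sum => s _.
apply: Gamma_mul.
  by case: (odd_perm s); rewrite /= ?expr1 ?expr0; [apply: GammaN|]; apply: Gamma1.
apply: Gamma_prod => i _; rewrite QmxE; case: ifP => _; first exact: Gamma_Q2.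
by case: ifP => _; [apply/GammaN/Gamma_Q2|apply: Gamma0].
Qed.

(** Newton's recursion can be solved for the power sums of odd index. *)
Lemma Gamma_psi_alphabet j : odd j -> Gamma (psi j alphabet).
Proof.
have [k] := ubnP j; elim: k j => // k IHk [|j] // jk oj.
have := pleth_q_rec j alphabet; rewrite big_ord_recl subn0 pleth_q0 mul1r oj.
move/eqP; rewrite -subr_eq => /eqP E.
have -> : psi j.+1 alphabet = (2%:R^-1 : rat) *: (2%:R *: psi j.+1 alphabet).
  by rewrite scalerA mulVf ?scale1r // Num.Theory.pnatr_eq0.
rewrite -E; apply/GammaZ/Gamma_add; first exact/GammaZ/Gamma_qn.
apply/GammaN/Gamma_sum => i _; apply: Gamma_mul; first exact: Gamma_qn.
case: ifP => oi; last exact: Gamma0.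
by apply/GammaZ/IHk => //; rewrite lift0; have := ltn_ord i; lia.
Qed.

Lemma Gamma_psi_q j (n : nat) : odd j -> Gamma (psi j (q n)).
Proof.
move=> oj; have j0 : (0 < j)%N by case: j oj.
have [k] := ubnP n; elim: k n => // k IHk [|n] nk.
  by rewrite q0 psi1 //; apply: Gamma1.
have n0 : n.+1%:R != 0 :> rat by rewrite Num.Theory.pnatr_eq0.
rewrite -[psi j _](scalerK n0) -psiZ pleth_q_rec psi_sum.
apply/GammaZ/Gamma_sum => i _; have ni : (0 < n.+1 - i)%N by rewrite subn_gt0.
rewrite psiM //; apply: Gamma_mul.
  by apply: IHk; have := ltn_ord i; lia.
case: ifP => oi; last by rewrite psi0; apply: Gamma0.
rewrite psiZ psi_psi //; apply/GammaZ/Gamma_psi_alphabet.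
by rewrite oddM oj oi.
Qed.

Lemma Gamma_pleth (n m : nat) : Gamma (pleth_q n (q m)).
Proof.
have [k] := ubnP n; elim: k n => // k IHk [|n] nk.
  by rewrite pleth_q0; apply: Gamma1.
have n0 : n.+1%:R != 0 :> rat by rewrite Num.Theory.pnatr_eq0.
rewrite -[pleth_q _ _](scalerK n0) pleth_q_rec.
apply/GammaZ/Gamma_sum => i _; apply: Gamma_mul.
  by apply: IHk; have := ltn_ord i; lia.
case: ifP => oi; last exact: Gamma0.
exact/GammaZ/Gamma_psi_q.
Qed.

(** As the Q_l span Gamma, any two operators with the prescribed values on
    them agree there. *)
Lemma Dop_Dk k f : (0 < k)%N -> Gamma f -> Dop k f = Dk k f.
Proof.
move=> k0 Gf; have [lin val] : is_Dop k (Dop k).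
  by apply: xgetPex; exists (Dk k); apply: is_Dop_Dk.
suff [] : Gamma f /\ Dop k f = Dk k f by [].
apply: (Gamma_QP_ind (W := fun f => Gamma f /\ Dop k f = Dk k f)) Gf.
- split; first exact: Gamma0.
  have := lin (-1) 0 0 Gamma0 Gamma0.
  by rewrite scaler0 addr0 scaleN1r addNr Dk_0.
- move=> c g h [Gg Eg] [Gh Eh]; split; first by apply/Gamma_add/Gh/GammaZ.
  by rewrite lin // Dk_linear Eg Eh.
- by move=> l sl; split; [apply: Gamma_QP|rewrite val // Dk_QP].
Qed.

(** * The series kappa_1 *)

Lemma ssum_nat (I : choiceType) (F : nat -> series I) m N :
    (forall n, (N <= n)%N -> F n m = 0) ->
  ssum [set: nat] F m = \sum_(n < N) F n m.
Proof.
move=> F0; rewrite /ssum (fsbigTE [fset n in iota 0 N]%fset); last first.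
  by move=> n; rewrite in_fset mem_iota /= -leqNgt => /F0.
rewrite -(big_mkord predT (fun n => F n m)) /index_iota subn0.
apply: perm_big; apply: uniq_perm; rewrite ?fset_uniq ?iota_uniq // => n.
by rewrite in_fset.
Qed.

Section Kappa1.
Variable d : nat.
Hypothesis d0 : (0 < d)%N.
Implicit Types P : series nat.

Lemma kappa1_eqdiv P m N : homog d P -> (mdeg m < N)%N ->
  eqdiv m (kappa1 P) (\sum_(n < N) pleth_q n P).
Proof.
move=> Pd mN a b abm; rewrite sumsE /kappa1; apply: ssum_nat => n Nn.
apply: (homog_eq0 (@homog_pleth_q d n P Pd)) => an.
move: mN; rewrite -abm mdegM an ltnNge => /negP; apply.
rewrite (leq_trans Nn) // (leq_trans _ (leq_addr _ _)) //.
by rewrite leq_pmulr.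
Qed.

Lemma sum_triangle (V : nmodType) (A : nat -> nat -> V) N :
  \sum_(n < N) \sum_(i < n.+1) A i (n - i)%N =
  \sum_(i < N) \sum_(j < N - i) A i j.
Proof.
elim: N => [|N IHN]; first by rewrite !big_ord0.
rewrite big_ord_recr {}IHN /=.
have -> : \sum_(i < N) \sum_(j < N - i) A i j = \sum_(i < N.+1) \sum_(j < N - i) A i j.
  by rewrite [RHS]big_ord_recr /= subnn big_ord0 addr0.
rewrite -big_split; apply: eq_bigr => i _.
have iN : (i <= N)%N by rewrite -ltnS.
by rewrite (subSn iN) big_ord_recr.
Qed.

Lemma kappa1D P P' : homog d P -> homog d P' ->
  kappa1 (P + P') = kappa1 P * kappa1 P'.
Proof.
move=> Pd P'd; apply/funext => m; have mN := ltnSn (mdeg m).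
rewrite (eqdiv_self (kappa1_eqdiv (homogD Pd P'd) mN)).
rewrite (eqdiv_self (eqdivM (kappa1_eqdiv Pd mN) (kappa1_eqdiv P'd mN))).
set N := (mdeg m).+1.
pose A i j := ((pleth_q (Posz i) P) * (pleth_q (Posz j) P')) m.
transitivity (\sum_(n < N) \sum_(i < n.+1) A i (n - i)%N).
  by rewrite sumsE; apply: eq_bigr => n _; rewrite pleth_qD sumsE.
rewrite sum_triangle mulr_suml sumsE; apply: eq_bigr => i _.
rewrite mulr_sumr sumsE (big_ord_widen N (fun j => A i j)) ?leq_subr //.
rewrite big_mkcond; apply: eq_bigr => j _; case: ltnP => // Nij.
apply/esym/(homog_eq0 (homogM (@homog_pleth_q d i P Pd) (@homog_pleth_q d j P' P'd))).
rewrite -mulnDl => E; have : (mdeg m < i + j)%N.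
  by move: Nij; rewrite leq_subLR.
by rewrite E ltnNge leq_pmulr.
Qed.

Lemma kappa1_0 : kappa1 0 = 1.
Proof.
apply/funext => m.
rewrite (eqdiv_self (kappa1_eqdiv (@homog0 _ d) (ltnSn _))).
rewrite big_ord_recl big1 ?addr0 ?pleth_q_zero // => i _.
by rewrite pleth_q_zero lift0.
Qed.

Lemma kappa1_sum (T : Type) (r : seq T) (F : T -> series nat) :
    (forall t, homog d (F t)) ->
  kappa1 (\sum_(t <- r) F t) = \prod_(t <- r) kappa1 (F t).
Proof.
move=> Fd; elim: r => [|t r IHr]; first by rewrite !big_nil kappa1_0.
by rewrite !big_cons kappa1D ?IHr //; apply: homog_sum.
Qed.

(** The components of kappa_1(P) are the q_n(P), which lie in degree n d. *)
Lemma hcomp_kappa1 P e : homog d P -> hcomp e (kappa1 P) =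
  if (d %| e)%N then pleth_q (e %/ d)%N P else 0.
Proof.
move=> Pd; apply/funext => m; rewrite /hcomp.
have term0 (n : nat) : (n * d)%N != mdeg m -> pleth_q n P m = 0.
  move=> ne; apply: (homog_eq0 (@homog_pleth_q d n P Pd)) => E.
  by rewrite E eqxx in ne.
case: (mdeg m =P e) => [me|me]; last first.
  case: ifP => // /dvdnP[n ne]; rewrite ne mulnK // term0 //.
  by rewrite -ne eq_sym; apply/eqP.
rewrite (eqdiv_self (kappa1_eqdiv Pd (ltnSn _))) sumsE me.
case: ifP => [/dvdnP[n ne]|nde].
  have nN : (n < e.+1)%N by rewrite ltnS ne leq_pmulr.
  rewrite (bigD1 (Ordinal nN)) //= big1 ?addr0; first by rewrite ne mulnK.
  move=> i; rewrite -(inj_eq val_inj) /= => ni.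
  apply: term0; rewrite me; apply: contra ni => /eqP E.
  by rewrite -(eqn_pmul2r d0) E; apply/eqP.
rewrite big1 // => i _; apply: term0; rewrite me.
by apply/eqP => E; rewrite -E dvdn_mull in nde.
Qed.

End Kappa1.

Lemma kappa1_shift P : kappa1 (shift P) = shift (kappa1 P).
Proof.
apply/funext => m; rewrite embedE /kappa1 /ssum.
under eq_fsbigr do rewrite pleth_q_shift embedE.
by case: eqP => // _; rewrite fsbig1.
Qed.

(** Taking the coefficient of u^(k+r) lowers degrees by k + r, and q_r restores
    the degree r. *)
Lemma Dk_hcomp k e f m :
  Dk k (hcomp e f) m = if e == (k + mdeg m)%N then Dk k f m else 0.
Proof.
have E : Dk k (hcomp e f) m = \sum_(r < (mdeg m).+1)
    (if e == (k + mdeg m)%N then ((-1) ^+ r *: (q r * acoef (k + r) f)) m else 0).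
  apply: eq_bigr => r _; rewrite !scalesE !mulsEm.
  transitivity ((-1) ^+ r * (\sum_(a <- mdivs m) \sum_(b <- mdivs m)
    (if e == (k + mdeg m)%N then (q r a * acoef (k + r) f b) *+ (mmul a b == m)
     else 0))).
    congr (_ * _); apply: eq_bigr => a _; apply: eq_bigr => b _.
    case: (mmul a b =P m) => [abm|_]; last by rewrite !mulr0n if_same.
    rewrite !mulr1n; have [qa|/(@homog_q r) ar] := eqVneq (q r a) 0.
      by rewrite qa !mul0r if_same.
    have -> : (k + mdeg m = k + r + mdeg b)%N.
      by have := congr1 (@mdeg _) abm; rewrite mdegM ar; lia.
    rewrite !coefE /hcomp mdeg_smon eq_sym.
    by case: eqP => // _; rewrite mulr0.
  case: eqP => // _; rewrite big1 ?mulr0 // => a _.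
  by rewrite big1.
rewrite E; case: eqP => // _; by rewrite big1.
Qed.

Lemma degreewise_Dop k m : (0 < k)%N -> (0 < m)%N ->
  degreewise (Dop k) (kappa1 (q m)) = Dk k (kappa1 (q m)).
Proof.
move=> k0 m0; apply/funext => mu; rewrite /degreewise /ssum.
have DD e : Dop k (hcomp e (kappa1 (q m))) = Dk k (hcomp e (kappa1 (q m))).
  apply: Dop_Dk => //; rewrite (hcomp_kappa1 m0) //; last exact: homog_q.
  by case: ifP => _; [apply: Gamma_pleth|apply: Gamma0].
rewrite (fsbigTE [fset (k + mdeg mu)%N]%fset).
  by rewrite big_seq_fset1 DD Dk_hcomp eqxx.
by move=> e; rewrite in_fset1 => /negPf ne; rewrite DD Dk_hcomp ne.
Qed.

(** ** Adjoining u to the alphabet of kappa_1(q_m) *)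

Lemma homog_shift d P : homog d P -> homog d (shift P).
Proof.
move=> Pd m; rewrite embedE; case: (m _ =P 0%N) => [m0 /Pd <-|_].
  by rewrite -{1}[m](smonK asplit) mdeg_smon m0.
by rewrite eqxx.
Qed.

Lemma homog_monom d (m : {cmonom nat}) : mdeg m = d -> homog d (monom m).
Proof.
by move=> md a; rewrite monomE; case: (a =P m) => [->|_]; rewrite ?eqxx.
Qed.

(** The sum of two copies is the term of degree s + 1 in u of q_m(u, A). *)
Definition qu m s : series nat := monom (u_mon s.+1) * shift (q (m - s.+1)%N).

Lemma homog_qu m s : (s < m)%N -> homog m (qu m s).
Proof.
move=> sm; rewrite -{1}(subnKC sm); apply: homogM.
  by apply: homog_monom; rewrite mdeg_smon mdeg1 addn0.
exact/homog_shift/homog_q.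
Qed.

Lemma q_branch (m : nat) : q m = shift (q m) + \sum_(s < m) (qu m s + qu m s).
Proof.
apply: (coefP (sp := asplit)) => j; rewrite coefD coef_embed coef_sum acoef_q.
have quE (s : nat) : acoef j (qu m s + qu m s) =
    if s.+1 == j then 2%:R *: q (m - j)%N else 0.
  rewrite coefD /qu mulrC coef_embedM -[monom _]mulr1 coef_monomM monom1 mul1r.
  rewrite coef1 subn_eq0; case: (ltngtP s.+1 j) => sj.
  - by rewrite mulr0 addr0.
  - by rewrite mulr0 addr0.
  - by rewrite sj mulr1 scaler_nat.
rewrite (eq_bigr (fun s : 'I_m => if s.+1 == j then 2%:R *: q (m - j)%N else 0));
  last by move=> s _; apply: quE.
case: j {quE} => [|j] /=.
  by rewrite big1 // addr0 scale1r subn0.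
rewrite add0r -big_mkcond /=; case: (ltnP j m) => jm.
  by rewrite (big_pred1 (Ordinal jm)).
rewrite big1 // => s /eqP[sj]; have := ltn_ord s; lia.
Qed.

(** The factor kappa_1(q_m) of the theorem is the part free of u. *)
Lemma kappa1_branch m : (0 < m)%N -> kappa1 (q m) =
  (\prod_(s < m) (kappa1 (qu m s) * kappa1 (qu m s))) * shift (kappa1 (q m)).
Proof.
move=> m0; rewrite {1}q_branch (kappa1D m0); first last.
- by apply: homog_sum => s _; apply: homogD; apply: homog_qu.
- exact/homog_shift/homog_q.
rewrite kappa1_shift mulrC (kappa1_sum m0); last first.
  by move=> s; apply: homogD; apply: homog_qu.
congr (_ * _); apply: eq_bigr => s _.
by rewrite (kappa1D m0) //; apply: homog_qu.
Qed.

(** Congruence modulo u^B. *)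
Definition eqcoef B (f g : series nat) :=
  forall j, (j < B)%N -> acoef j f = acoef j g.

Lemma eqcoefM B f f' g g' :
  eqcoef B f f' -> eqcoef B g g' -> eqcoef B (f * g) (f' * g').
Proof.
move=> ff gg j jB; rewrite !coefM; apply: eq_bigr => i _.
have ij := ltn_ord i.
by rewrite ff ?gg //; lia.
Qed.

Lemma eqcoef_prod B (T : Type) (r : seq T) (F G : T -> series nat) :
  (forall t, eqcoef B (F t) (G t)) ->
  eqcoef B (\prod_(t <- r) F t) (\prod_(t <- r) G t).
Proof.
move=> FG; elim: r => [|t r IHr]; first by rewrite !big_nil.
by rewrite !big_cons; apply: eqcoefM.
Qed.

Lemma acoef_u j e X : acoef j (monom (u_mon e) * shift X) =
  if e == j then X else 0.
Proof.
rewrite mulrC coef_embedM -[monom _]mulr1 coef_monomM monom1 mul1r coef1 subn_eq0.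
by case: (ltngtP e j); rewrite ?mulr0 ?mulr1.
Qed.

(** The term of index i of kappa_1 (qu m s), see kappa1_qu. *)
Definition quX m s (i : nat) : series nat :=
  monom (u_mon (i * s.+1)) * shift (pleth_q i (q (m - s.+1)%N)).

Lemma kappa1_qu m s B :
  eqcoef B (kappa1 (qu m s)) (\sum_(i < B) quX m s i).
Proof.
move=> j jB; apply/funext => mu; rewrite coefE /kappa1.
have E (n : nat) : pleth_q n (qu m s) = quX m s n.
  by rewrite /qu pleth_q_monomM pleth_q_shift /u_mon scalem_smon scalem1.
have E' (n : nat) : pleth_q n (qu m s) (smon asplit j mu) =
    if (n * s.+1)%N == j then pleth_q n (q (m - s.+1)%N) mu else 0.
  by rewrite E -coefE /quX acoef_u; case: eqP.
rewrite (@ssum_nat _ _ _ B) => [|n Bn].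
  by rewrite coef_sum sumsE; apply: eq_bigr => n _; rewrite E coefE.
rewrite E'; case: eqP => // nj; have : (j < n * s.+1)%N.
  by rewrite (leq_trans jB) // (leq_trans Bn) // leq_pmulr.
by rewrite nj ltnn.
Qed.

Definition pairdot m B (f : {ffun 'I_m -> 'I_B * 'I_B}) : nat :=
  \sum_(s < m) ((f s).1 + (f s).2) * s.+1.

Definition pairprod m B (f : {ffun 'I_m -> 'I_B * 'I_B}) : series nat :=
  \prod_(s < m) (pleth_q (f s).1 (q (m - s.+1)%N) *
                 pleth_q (f s).2 (q (m - s.+1)%N)).

Lemma acoef_kappa1_branch m B j : (j < B)%N ->
  acoef j (\prod_(s < m) (kappa1 (qu m s) * kappa1 (qu m s))) =
  \sum_(f : {ffun 'I_m -> 'I_B * 'I_B} | pairdot f == j) pairprod f.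
Proof.
move=> jB; transitivity (acoef j (\prod_(s < m) \sum_(p : 'I_B * 'I_B)
    (quX m s p.1 * quX m s p.2))).
  apply: (eqcoef_prod (B := B)) => // s l lB.
  rewrite (eqcoefM (@kappa1_qu m s B) (@kappa1_qu m s B) lB); congr (acoef _ _).
  rewrite mulr_suml -(pair_bigA _ (fun i j : 'I_B => quX m s i * quX m s j)) /=.
  by apply: eq_bigr => i _; rewrite mulr_sumr.
rewrite bigA_distr_bigA coef_sum [RHS]big_mkcond; apply: eq_bigr => f _.
have -> : \prod_(s < m) (quX m s (f s).1 * quX m s (f s).2) =
    monom (u_mon (pairdot f)) * shift (pairprod f).
  rewrite /pairprod embed_prod.
  have -> : monom (u_mon (pairdot f)) =
      \prod_(s < m) monom (u_mon (((f s).1 + (f s).2) * s.+1)).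
    rewrite /pairdot; elim/big_rec2: _ => [|s x y _ <-].
      by rewrite /u_mon smon1 monom1.
    by rewrite monomM /u_mon smonM mulm1.
  rewrite -big_split; apply: eq_bigr => s _.
  by rewrite /quX embedM mulrACA monomM /u_mon smonM mulm1 mulnDl.
by rewrite acoef_u.
Qed.

Lemma natz_sub (m s : nat) : (s < m)%N -> m%:Z - (s.+1)%:Z = (m - s.+1)%N%:Z.
Proof. by move=> sm; rewrite subzn. Qed.

Lemma prods_neq0 (I : choiceType) (T : eqType) (r : seq T) (F : T -> series I) :
  \prod_(t <- r) F t != 0 -> forall t, t \in r -> F t != 0.
Proof.
move=> nz t tr; apply: contraNneq nz => F0.
by rewrite (big_rem _ tr) /= F0 mul0r.
Qed.

(** The indices of the sum, with I and J encoded by one function, when all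
    entries are natural numbers below a bound. *)
Definition index_triple m B (t : {ffun 'I_m -> 'I_B * 'I_B} * nat) :
    {ffun 'I_m -> int} * {ffun 'I_m -> int} * int :=
  ([ffun s => Posz (t.1 s).1], [ffun s => Posz (t.1 s).2], Posz t.2).

Lemma index_triple_inj m B : injective (@index_triple m B).
Proof.
move=> [f r] [g r'] [/ffunP fg1 /ffunP fg2 <-]; congr (_, _).
apply/ffunP => s; have := fg2 s; have := fg1 s; rewrite !ffunE => -[e1] [e2].
by apply/eqP; rewrite -pair_eqE /pair_eq -!val_eqE /= e1 e2 !eqxx.
Qed.

(** * The theorem *)

Lemma Posz_pairdot m (i j : 'I_m -> nat) :
  \sum_(s < m) (Posz (i s) + Posz (j s)) * (s.+1)%:Z =
  Posz (\sum_(s < m) (i s + j s) * s.+1).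
Proof.
by rewrite (big_morph Posz PoszD (erefl (Posz 0))).
Qed.

(** A nonzero q_n(P) has a nonnegative index, and q_r has degree r; once r is
    bounded by the degree of mu, the constraint bounds the entries of I and J. *)
Lemma index_triple_onto m k (mu : {cmonom nat}) (i j : {ffun 'I_m -> int}) r :
    \sum_(s < m) (i s + j s) * (s.+1)%:Z - r = k%:Z ->
    (q r * \prod_(s < m) (pleth_q (i s) (q (m%:Z - (s.+1)%:Z)) *
                          pleth_q (j s) (q (m%:Z - (s.+1)%:Z)))) mu != 0 ->
  exists (f : {ffun 'I_m -> 'I_(k + (mdeg mu).+1) * 'I_(k + (mdeg mu).+1)})
         (r' : nat),
    (r' < (mdeg mu).+1)%N /\ (i, j, r) = index_triple (f, r').
Proof.
move=> dot /muls_neq0[a [b [ab qa pb]]].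
have pleth_pos (n : int) X : pleth_q n X != 0 -> exists n' : nat, n = n'.
  by case: n => [n'|n'] => [_|]; [exists n' | rewrite eqxx].
have {pb}factor s : pleth_q (i s) (q (m%:Z - (s.+1)%:Z)) *
    pleth_q (j s) (q (m%:Z - (s.+1)%:Z)) != 0.
  have nz : \prod_(s < m) (pleth_q (i s) (q (m%:Z - (s.+1)%:Z)) *
      pleth_q (j s) (q (m%:Z - (s.+1)%:Z))) != 0.
    by apply: contraNneq pb => ->.
  exact: (prods_neq0 nz (mem_index_enum s)).
have ij s : exists p : nat * nat, i s = p.1 /\ j s = p.2.
  have [|i' ei] := @pleth_pos (i s) (q (m%:Z - (s.+1)%:Z)).
    by apply: contraNneq (factor s) => ->; rewrite mul0r.
  have [|j' ej] := @pleth_pos (j s) (q (m%:Z - (s.+1)%:Z)).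
    by apply: contraNneq (factor s) => ->; rewrite mulr0.
  by exists (i', j').
have [p pE] := choice ij.
have [r' er] : exists r' : nat, r = r'.
  by apply: (@pleth_pos r alphabet); apply: contraNneq qa => rq; rewrite /q rq.
have ra : (r' <= mdeg mu)%N.
  rewrite er in qa; rewrite -(homog_q qa) -ab mdegM.
  exact: leq_addr.
have bound s : ((p s).1 + (p s).2 < k + (mdeg mu).+1)%N.
  have : (\sum_(s < m) ((p s).1 + (p s).2) * s.+1 = k + r')%N.
    move: dot; rewrite er => /eqP; rewrite subr_eq => /eqP dot.
    suff : Posz (\sum_(s < m) ((p s).1 + (p s).2) * s.+1) = Posz (k + r').
      by case.
    rewrite PoszD -dot -(Posz_pairdot (fun s => (p s).1) (fun s => (p s).2)).
    by apply: eq_bigr => t _; have [-> ->] := pE t.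
  rewrite (bigD1 s) //= => dotn; rewrite addnS ltnS.
  have : ((p s).1 + (p s).2 <= ((p s).1 + (p s).2) * s.+1)%N by apply: leq_pmulr.
  move: dotn; move: (\sum_(t < m | _) _)%N (_ * s.+1)%N => x y; lia.
have bound1 s : ((p s).1 < k + (mdeg mu).+1)%N by have := bound s; lia.
have bound2 s : ((p s).2 < k + (mdeg mu).+1)%N by have := bound s; lia.
exists [ffun s => (Ordinal (bound1 s), Ordinal (bound2 s))], r'; split=> //.
rewrite /index_triple er; congr (_, _, _); apply/ffunP => s; rewrite !ffunE /=.
  by have [] := pE s.
by have [] := pE s.
Qed.

Theorem theorem4p3 (m k : nat) (hm : (0 < m)%N) (hk : (0 < k)%N) :
  degreewise (Dop k) (kappa1 (q m)) =
  kappa1 (q m) *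
  ssum [set t : {ffun 'I_m -> int} * {ffun 'I_m -> int} * int |
          let: (i, j, r) := t in
          \sum_(s < m) (i s + j s) * (s.+1)%:Z - r = k%:Z]
    (fun t => let: (i, j, r) := t in
       ((-1) ^ r : rat) *: (q r *
       \prod_(s < m) (pleth_q (i s) (q (m%:Z - (s.+1)%:Z)) *
                      pleth_q (j s) (q (m%:Z - (s.+1)%:Z))))).
Proof.
rewrite degreewise_Dop // (kappa1_branch hm) Dk_shiftM mulrC.
rewrite -(kappa1_branch hm); congr (_ * _).
apply/funext => mu; pose R := (mdeg mu).+1; pose B := (k + R)%N.
rewrite (DkE _ _ (ltnSn (mdeg mu))) -/R.
pose G (t : {ffun 'I_m -> int} * {ffun 'I_m -> int} * int) : series nat :=
  let: (i, j, r) := t in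
  ((-1) ^ r : rat) *: (q r *
     \prod_(s < m) (pleth_q (i s) (q (m%:Z - (s.+1)%:Z)) *
                    pleth_q (j s) (q (m%:Z - (s.+1)%:Z)))).
pose P (t : {ffun 'I_m -> int} * {ffun 'I_m -> int} * int) : bool :=
  let: (i, j, r) := t in
  \sum_(s < m) (i s + j s) * (s.+1)%:Z - r == k%:Z.
rewrite /ssum (_ : [set t | _] = [set` P]); last first.
  by apply/seteqP; split=> -[[i j] r] /=; [move/eqP|move/eqP].
(* The indices of the terms that contribute to the coefficient of mu. *)
pose E := [seq (f, r) | f <- enum {ffun 'I_m -> 'I_B * 'I_B}, r <- iota 0 R].
have uE : uniq (map (@index_triple m B) E).
  rewrite map_inj_uniq; last exact: index_triple_inj.
  apply: allpairs_uniq; rewrite ?enum_uniq ?iota_uniq //.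
  by move=> [? ?] [? ?] _ _.
have sumE (F : {ffun 'I_m -> 'I_B * 'I_B} * nat -> rat) :
    \sum_(t <- E) F t = \sum_(f : {ffun 'I_m -> 'I_B * 'I_B}) \sum_(r < R) F (f, r : nat).
  rewrite big_flatten big_map big_enum; apply: eq_bigr => f _.
  by rewrite big_map -(big_mkord predT (fun r => F (f, r))) /index_iota subn0.
rewrite -(@bigfs _ _ _ _ _ P _ uE); last first.
  move=> [[i j] r] Pt; apply: contraNeq => Gt.
  have [|f [r' [r'R ->]]] := @index_triple_onto m k mu i j r (eqP Pt).
    by move: Gt; rewrite scalesE mulf_eq0 negb_or => /andP[].
  apply/mapP; exists (f, r') => //; apply/allpairsP; exists (f, r').
  by split; rewrite ?mem_enum ?mem_iota.

rewrite [RHS]big_map [RHS]big_mkcond [RHS]sumE [RHS]exchange_big; apply: eq_bigr => r _.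
have rB : (k + r < B)%N by rewrite ltn_add2l.
rewrite (acoef_kappa1_branch m rB) mulr_sumr scaler_sumr sumsE [LHS]big_mkcond.
apply: eq_bigr => f _.
have -> : P (index_triple (f, r : nat)) = (pairdot f == k + r)%N.
  rewrite /P /= subr_eq -PoszD -eqz_nat /pairdot -Posz_pairdot.
  by congr (_ == _); apply: eq_bigr => s _; rewrite !ffunE.
case: ifP => // _; congr (((_ *: (_ * _)) : series nat) mu).
by apply: eq_bigr => s _; rewrite !ffunE natz_sub.
Qed.
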